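(* Let $h:[0,\infty)\to[0,\infty)$ be a locally bounded measurable function such that $h\circ L^{\leftarrow}$ is regularly varying at infinity with index $\alpha\in\mathbb{R}$. If $\mathbb{P}\{\xi>x\}\sim \frac{1}{L(x)}$ as $x\to+\infty$, then for every $n\in\mathbb{N}$ and $0<u_1<\ldots<u_n<\infty$, the following convergence in distribution of random vectors holds as $t\to\infty$: $$\left(\frac{Y(L^{\leftarrow}(tu_1))}{t\,h(L^{\leftarrow}(t))},\ldots,\frac{Y(L^{\leftarrow}(tu_n))}{t\,h(L^{\leftarrow}(t))}\right)\stackrel{\rm d}{\to} \left(u_1^{\alpha}m^{\leftarrow}(u_1),\ldots,u_n^{\alpha}m^{\leftarrow}(u_n)\right).$$
   Context: Let $\xi_1,\xi_2,\ldots$ be independent copies of a positive (real-valued) random variable $\xi$. Put $S_0:=0$ and $S_n:=\xi_1+\ldots+\xi_n$ for $n\in\mathbb{N}=\{1,2,\ldots\}$. The first-passage time process is $\nu(t):=\inf\{k\in\mathbb{N}:S_k>t\}$, $t\ge 0$. For a locally bounded measurable $h$, the renewal shot noise process is $$Y(t):=\sum_{k=0}^{\infty}h(t-S_k)\mathbf{1}_{\{S_k\le t\}}=\sum_{k=0}^{\nu(t)-1}h(t-S_k),\quad t\ge 0.$$ The function $L:[0,\infty)\to[0,\infty)$ is slowly varying at infinity, strictly increasing and continuous on $[0,\infty)$ with $L(0)=0$ (and $L(x)\to\infty$ as $x\to\infty$). $L^{\leftarrow}:[0,\infty)\to[0,\infty)$ denotes its inverse function, so $L^{\leftarrow}(L(t))=L(L^{\leftarrow}(t))=t$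 for all $t\ge 0$. A measurable function $g:[0,\infty)\to[0,\infty)$, positive on a neighbourhood of infinity, is regularly varying at infinity with index $\alpha$ if $g(\lambda x)/g(x)\to\lambda^{\alpha}$ as $x\to\infty$ for every $\lambda>0$; it is slowly varying if $\alpha=0$. The notation $f(x)\sim g(x)$ means $f(x)/g(x)\to1$. Let $\mathcal{P}=\sum_k\delta_{(t_k,y_k)}$ be a Poisson point process on $[0,\infty)\times(0,\infty]$ with intensity $dt\times y^{-2}dy$, where $\delta_x$ is the Dirac measure at $x$. The extremal process is $m(u):=\max_{k:\,t_k\le u}y_k$, $u\ge0$ (the maximum over the empty set being $0$), and its generalized inverse is $m^{\leftarrow}(u):=\inf\{y\ge0: m(y)>u\}$, $u\ge0$. *)

(* Defs.v *)
From HB Require Import structures.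
From mathcomp Require Import all_boot all_order all_algebra.
From mathcomp Require Import all_classical all_reals all_analysis.
From mathcomp Require Import measurable_realfun.

Set Implicit Arguments.
Unset Strict Implicit.
Unset Printing Implicit Defensive.

Import Order.TTheory GRing.Theory Num.Theory numFieldNormedType.Exports.
Local Open Scope classical_set_scope.
Local Open Scope ring_scope.

(* Functions on [0, +oo) are represented by total functions on R of which only
   the values on [0, +oo) are ever constrained or used. *)

Definition regularly_varying (R : realType) (g : R -> R) (alpha : R) : Prop :=
  [/\ measurable_fun `[(0 : R), +oo[ g,
      (forall x, 0 <= x -> 0 <= g x),
      (\forall x \near +oo, 0 < g x) &
      (forall lambda, 0 < lambda ->
         (g (lambda * x) / g x) @[x --> +oo] --> lambda `^ alpha)].

Definition slowly_varying (R : realType) (g : R -> R) : Prop :=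
  regularly_varying g 0.

Definition locally_bounded (R : realType) (h : R -> R) : Prop :=
  forall b : R, [bounded h x | x in `[0, b]].

Definition asymp_equiv (R : realType) (f g : R -> R) : Prop :=
  (f x / g x) @[x --> +oo] --> (1 : R).

Definition independent_family (d d' : measure_display)
    (Omega : measurableType d) (T : measurableType d') (R : realType)
    (P : probability Omega R) (I : eqType) (X : I -> Omega -> T) : Prop :=
  forall (s : seq I) (B : I -> set T), uniq s ->
    (forall i, measurable (B i)) ->
    P (\bigcap_(i in [set` s]) (X i @^-1` B i)) =
    (\prod_(i <- s) P (X i @^-1` B i))%E.

(* X t converges in distribution, as t --> +oo, to Z. *)
Definition cvg_in_distribution (d d' : measure_display)
    (Omega : measurableType d) (Omega' : measurableType d') (R : realType)
    (P : probability Omega R) (P' : probability Omega' R) (n : nat)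
    (X : R -> Omega -> 'rV[R]_n) (Z : Omega' -> 'rV[R]_n) : Prop :=
  forall f : 'rV[R]_n -> R, continuous f ->
    (exists M : R, forall x, `|f x| <= M) ->
    ('E_P[f \o X t])%E @[t --> +oo] --> ('E_P'[f \o Z])%E.

Section shot_noise.
Context (R : realType) (Omega : Type) (xi : nat -> Omega -> R).

(* xi is indexed from 0, so that xi i is the (i+1)-st step of the walk. *)
Definition random_walk (k : nat) (w : Omega) : R := \sum_(i < k) xi i w.

(* Extended-valued: the sum may diverge where the walk stays bounded, which is
   a null event for i.i.d. positive steps. *)
Definition shot_noise (h : R -> R) (t : R) (w : Omega) : \bar R :=
  (\sum_(0 <= k <oo)
     (if (random_walk k w <= t)%R then h (t - random_walk k w)%R else 0%R)%:E)%E.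

End shot_noise.

Section point_process.
Context (d d' : measure_display) (Omega : measurableType d)
  (T : measurableType d') (R : realType).

(* The number of indices k with X k w \in A, i.e. the mass that the random
   measure \sum_k \d_(X k) gives to A. *)
Definition count_points (X : nat -> Omega -> T) (A : set T) (w : Omega)
    : \bar R :=
  (\sum_(0 <= k <oo) \d_(X k w) A)%E.

(* The atoms are enumerated by nat: this covers only intensities of infinite
   total mass. The Poisson weights are written out because poisson_pmf is not
   the Dirac mass at 0 when the rate is 0. *)
Definition poisson_point_process (P : probability Omega R) (E : set T)
    (mu : set T -> \bar R) (X : nat -> Omega -> T) : Prop :=
  [/\ (forall k, measurable_fun setT (X k)),
      (forall k w, E (X k w)),
      (forall A, measurable A -> A `<=` E -> (mu A < +oo)%E ->
         forall j : nat, P [set w | count_points X A w = j%:R%:E] =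
           (expR (- fine (mu A)) * fine (mu A) ^+ j / j`!%:R)%:E),
      (forall A, measurable A -> A `<=` E -> mu A = +oo%E ->
         P [set w | count_points X A w = +oo%E] = 1%E) &
      (forall (n : nat) (A : 'I_n -> set T),
         (forall i, measurable (A i)) -> (forall i, A i `<=` E) ->
         trivIset setT A ->
         independent_family P (fun i => count_points X (A i)))].

End point_process.

Section extremal_process.
Context (R : realType).

Definition extremal_space : set (R * \bar R) :=
  [set p | (0 <= p.1)%R /\ (0 < p.2)%E].

(* dt * y^-2 dy on [0, +oo) * (0, +oo]; the points with y = +oo carry no
   mass. *)
Definition extremal_intensity (A : set (R * \bar R)) : \bar R :=
  (\int[lebesgue_measure]_(t in `[0%R, +oo[)
     \int[lebesgue_measure]_(y in `]0%R, +oo[)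
       (\1_A (t, y%:E) * y ^- 2)%R%:E)%E.

Context (Omega : Type) (X : nat -> Omega -> R * \bar R).

(* Almost surely the supremum is attained and, for u > 0, extremal_inverse u is
   finite. *)
Definition extremal_process (u : R) (w : Omega) : \bar R :=
  ereal_sup ([set 0%E] `|`
             [set (X k w).2 | k in [set k | (X k w).1 <= u]]).

Definition extremal_inverse (u : R) (w : Omega) : \bar R :=
  ereal_inf [set y%:E | y in
    [set y : R | 0 <= y /\ (u%:E < extremal_process y w)%E]].

End extremal_process.

(* Main.v *)
Require Import Defs.
From HB Require Import structures.
From mathcomp Require Import all_boot all_order all_algebra.
From mathcomp Require Import all_classical all_reals all_analysis.
From mathcomp Require Import measurable_realfun.
From mathcomp Require Import ring lra.

Set Implicit Arguments.
Unset Strict Implicit.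
Unset Printing Implicit Defensive.

Import Order.TTheory GRing.Theory Num.Theory numFieldNormedType.Exports.
Local Open Scope classical_set_scope.
Local Open Scope ring_scope.

(* Because the tail of xi is slowly varying, the walk crosses a high level x in
   a single jump: with probability close to 1, the first step larger than x
   occurs while the walk is still below x / 2.  On that event, at time x the
   shot noise is the sum of tau(x) values of h on [x / 2, x], where tau(x) is
   the (geometric) index of the first step larger than x, and each of these
   values is close to h x, by the uniform convergence theorem for h \o Linv and
   the slow variation of L.  Hence Y(Linv (t u)) / (t h(Linv t)) is close to
   u^alpha tau(Linv (t u)) / t.  For i.i.d. steps the joint survival function of
   the variables tau(Linv (t u_i)) / t is explicit; it converges to the
   probability that the Poisson process has no point in a staircase-shaped
   region, which is the joint survival function of the inverse extremal process.
   Convergence of survival functions implies convergence in distribution. *)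

(** * Uniform convergence for regularly varying functions *)

(** The picture of a single jump needs a quantitative input: about [L x] steps are made before one
    exceeds [x], so the sum of the smaller steps is negligible only if the mean of [xi] truncated at
    [x] is o(x / L x). A deterministic horizon [K * L x] then replaces the random index tau(x), and
    Markov's inequality applies. For [y] in [x / 2, x], slow variation puts [L y] into
    [lam * L x, L x] with [lam] as close to 1 as desired. Uniform convergence is therefore needed
    only on a short window to the left of the argument. The errors made on [Y] are multiplicative,
    so they can be moved to the thresholds [s]. The exponent of the limiting survival function is
    homogeneous in [s], which makes these perturbations vanish in the limit. The coordinates of the
    limit are almost surely positive. Hence survival functions at thresholds [s >= 0] carry all the
    information, and tightness comes from the convergence itself. *)

Lemma lebesgue_measure_translate (R : realType) (a : R) (A : set R) :
  measurable A ->
  lebesgue_measure ((fun y : measurableTypeR R => y - a) @^-1` A)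
  = lebesgue_measure A.
Proof.
move=> mA.
have mf : measurable_fun setT
    (fun y : measurableTypeR R => (y - a : measurableTypeR R)).
  by apply: measurable_funB => //; exact: measurable_cst.
pose f : {mfun measurableTypeR R >-> measurableTypeR R} :=
  HB.pack (fun y : measurableTypeR R => (y - a : measurableTypeR R))
    (isMeasurableFun.Build _ _ _ _ _ mf).
rewrite -/(pushforward lebesgue_measure f A).
apply/esym/lebesgue_measure_unique => //= _ [[b c]] _ <-.
rewrite /pushforward.
rewrite (_ : _ @^-1` _ = `](b + a), (c + a)]%classic); last first.
  by apply/seteqP; split=> y /=; rewrite !in_itv/= ltrBrDr lerBlDr.
rewrite !lebesgue_measure_itv/= !lte_fin ltrD2r.
by case: ifP => // _; rewrite -!EFinB opprD addrACA subrr addr0.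
Qed.

Section uniform_convergence.
Variables (R : realType) (f : R -> R).
Hypothesis mf : measurable_fun setT f.
Hypothesis f0 : forall y, 0 <= y -> (f (v + y) - f v) @[v --> +oo] --> 0.

Let settled (w : nat -> R) (eps : R) (N : nat) : set R :=
  `[0, 2] `&` [set y | forall m, (N <= m)%N -> `|f (w m + y) - f (w m)| < eps].

(** The sets [settled w eps N] increase with [N] and exhaust [0, 2] by pointwise convergence, so by
    continuity from below their measures tend to 2. Any bound below 2 is reached; 3/2 is half the
    length of the interval [0, 3] in which two such sets are made to collide. *)
Lemma egorov_shift (w : nat -> R) (eps : R) : w n @[n --> \oo] --> +oo -> 0 < eps ->
  exists2 N, measurable (settled w eps N) &
    ((3 / 2)%:E < lebesgue_measure (settled w eps N))%E.
Proof.
move=> woo e0.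
pose A := settled w eps.
have mA N : measurable (A N).
  rewrite /A /settled (_ : [set y | _] = \bigcap_(m in [set m | (N <= m)%N])
     ((fun y => `|f (w m + y) - f (w m)|) @^-1` `]-oo, eps[)); last first.
    by apply/seteqP; split=> y /= h m /h; rewrite /= in_itv.
  apply: measurableI => //; apply: bigcap_measurable; first by exists N => /=.
  move=> m _; rewrite -[X in measurable X]setTI.
  apply: (measurableT_comp (@normr_measurable R setT)) => //.
  apply: measurable_funB => //; apply: measurableT_comp => //.
  exact: measurable_funD.
have ndA : nondecreasing_seq A.
  move=> n m nm; apply/subsetPset => y [y02 hy]; split => // k mk.
  by apply: hy; exact: leq_trans mk.
have cA : \bigcup_n A n = `[0, 2]%classic.
  apply/seteqP; split => [y [n _ []]//|y y02].
  have y0 : 0 <= y by move: y02; rewrite /= in_itv/= => /andP[].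
  have /cvgrPdist_lt/(_ _ e0) h := cvg_comp _ _ woo (f0 y0).
  case: h => N _ hN; exists N => //; split => // m Nm.
  by have := hN m Nm; rewrite /= sub0r normrN.
have cv : lebesgue_measure (A n) @[n --> \oo] --> (2%:E : \bar R).
  have <- : lebesgue_measure (\bigcup_n A n) = (2%:E : \bar R).
    have := lebesgue_measure_itv `[0%R, 2%R : R].
    by rewrite /= lte_fin ltr0n/= sube0 cA.
  by apply: nondecreasing_cvg_mu => //; exact: bigcupT_measurable.
have : ((3 / 2 : R)%:E < 2%:E)%E by rewrite lte_fin; lra.
move=> h1; have [] := cv [set z | ((3 / 2)%:E < z)%E].
  by apply: open_nbhs_nbhs; split => //; exact: open_ereal_gt_ereal.
move=> N _ hN.
by exists N => //; exact: (hN N (leqnn N)).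
Qed.

(* Otherwise [`|f (v_n + y_n) - f v_n| >= eps] along some [v_n --> +oo] with
   [y_n] in [0, 1].  The increments of [f] from [v_n] and from [v_n + y_n] are
   smaller than [eps / 2] on subsets of [0, 2] of measure > 3/2; translating the
   second one by [y_n], both lie in [0, 3], hence they intersect. *)
Lemma uniform_convergence_slowly_varying (eps : R) : 0 < eps ->
  \forall v \near +oo, forall y, 0 <= y <= 1 -> `|f (v + y) - f v| < eps.
Proof.
move=> e0; apply: contrapT => hn.
have hs (n : nat) : exists vy : R * R, [/\ n%:R <= vy.1, 0 <= vy.2 <= 1 &
    eps <= `|f (vy.1 + vy.2) - f vy.1|].
  apply: contrapT => hN; apply: hn; exists n%:R; split; first exact: num_real.
  move=> v nv y y01; rewrite ltNge; apply/negP => h.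
  by apply: hN; exists (v, y); split => //=; exact: ltW.
have [vy hvy] := choice hs.
have v1oo : (vy n).1 @[n --> \oo] --> +oo.
  apply/cvgryPge => M; near=> n; have [h _ _] := hvy n; apply: le_trans h.
  by near: n; exact: nbhs_infty_ger.
have v2oo : ((vy n).1 + (vy n).2) @[n --> \oo] --> +oo.
  apply/cvgryPge => M; near=> n; have [_ /andP[h _] _] := hvy n.
  rewrite -[M]addr0; apply: lerD => //.
  near: n; move/cvgryPge : v1oo; exact.
have e20 : 0 < eps / 2 by rewrite divr_gt0.
have [N1 mA hA] := egorov_shift v1oo e20.
have [N2 mB hB] := egorov_shift v2oo e20.
set A := settled _ _ _ in mA hA; set B := settled _ _ _ in mB hB.
pose n := maxn N1 N2; have [_ /andP[y0 y1] hvn] := hvy n.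
set v := (vy n).1 in y0 y1 hvn; set y := (vy n).2 in y0 y1 hvn.
pose B' := (fun z : measurableTypeR R => z - y) @^-1` B.
have mB' : measurable B'.
  rewrite /B' -[X in measurable X]setTI.
  by apply: measurable_funB.
have sub03 (z : R) : A z \/ B (z - y) -> `[0, 3]%classic z.
  case=> -[+ _]; rewrite /= !in_itv/= => /andP[z0 z1];
  by apply/andP; split; lra.
have [h|/set0P[z [Az Bz]]] := eqVneq (A `&` B') set0.
  have : (lebesgue_measure (A `|` B') <= 3%:E :> \bar R)%E.
    have -> : (3%:E : \bar R) = lebesgue_measure `[0%R, 3%R : R].
      by rewrite lebesgue_measure_itv/= lte_fin ltr0n/= sube0.
    apply: le_measure; rewrite ?inE//; exact: measurableU.
  rewrite measureU//.
  rewrite leNgt => /negP; apply.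
  rewrite (_ : 3 = 3/2 + 3/2 :> R)%R; last by lra.
  rewrite EFinD; apply: lteD => //.
  by move: hB; rewrite -(lebesgue_measure_translate y mB).
have /= h1 := Az.2 n (leq_maxl _ _); have /= h2 := Bz.2 n (leq_maxr _ _).
move: h1 h2 hvn; rewrite -/v -/y (_ : v + y + (z - y) = v + z); last by lra.
rewrite !ltr_norml => /andP[h1 h2] /andP[h3 h4].
by rewrite leNgt => /negP; apply; rewrite ltr_norml; apply/andP; split; lra.
Unshelve. all: by end_near.
Qed.

End uniform_convergence.

Lemma expR_cvgy (R : realType) : expR (x : R) @[x --> +oo] --> +oo.
Proof.
apply/cvgryPge => M; near=> x; apply: le_trans (expR_ge1Dx x).
by rewrite -lerBlDl; near: x; exact: nbhs_pinfty_ge (num_real _).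
Unshelve. all: by end_near.
Qed.

Section regular_variation.
Variables (R : realType) (g : R -> R) (alpha : R).
Hypothesis rg : regularly_varying g alpha.

(** The exponential change of variable turns the dilation by [lambda] into a translation.
    Subtracting [alpha * v] reduces the index to 0, so that the increments of [logg] tend to 0. *)
Let logg (v : R) := ln (g (expR v)) - alpha * v.

Let measurable_logg : measurable_fun setT logg.
Proof.
case: rg => mg _ _ _; apply: measurable_funB; last exact: mulrl_measurable.
apply: (measurableT_comp (@measurable_ln R)).
apply: (@measurable_comp _ _ _ _ _ _ [set` `[(0 : R), +oo[] g setT expR) => //.
by move=> _ [v _ <-]; rewrite /= in_itv/= expR_ge0.
Qed.

Let logg_slow (y : R) : 0 <= y -> (logg (v + y) - logg v) @[v --> +oo] --> 0.
Proof.
case: rg => _ _ gpos gcvg y0.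
have h1 : (g (expR y * expR v) / g (expR v)) @[v --> +oo] --> expR y `^ alpha.
  exact: (cvg_comp _ _ (@expR_cvgy R) (gcvg _ (expR_gt0 y))).
have h2 : ln (g (expR y * expR v) / g (expR v)) @[v --> +oo] -->
    ln (expR y `^ alpha).
  by apply: (cvg_comp _ _ h1); apply: continuous_ln; rewrite powR_gt0 ?expR_gt0.
rewrite ln_powR expRK in h2.
have h3 : (ln (g (expR y * expR v) / g (expR v)) - alpha * y) @[v --> +oo] --> 0.
  by rewrite -[X in _ --> X](subrr (alpha * y)); apply: cvgB => //; exact: cvg_cst.
apply: cvg_trans h3; apply: near_eq_cvg.
have n1 : \forall v \near +oo, 0 < g (expR v) by exact: expR_cvgy gpos.
have n2 : \forall v \near +oo, 0 < g (expR (v + y)) by exact: cvg_addrr n1.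
near=> v.
have g1 : 0 < g (expR v) by near: v; exact: n1.
have g2 : 0 < g (expR (v + y)) by near: v; exact: n2.
rewrite /logg -expRD [y + v]addrC ln_div ?posrE// mulrDr; lra.
Unshelve. all: by end_near.
Qed.

(** The increment of [ln g] from [s] to [x] is that of [logg] from [ln s] to [ln x], plus
    [alpha * (ln x - ln s)]. The first is uniformly small; the second is small because [lam] is
    close to 1. The base point is [ln s] because the uniform estimate looks to the right. *)
Lemma regularly_varying_left_uniform (eps : R) : 0 < eps ->
  exists2 lam : R, 0 < lam < 1 & \forall x \near +oo,
    forall s, lam * x <= s <= x -> `|g s / g x - 1| < eps.
Proof.
move=> e0; case: rg => _ _ gpos _.
have [d d0 hd] : exists2 d : R, 0 < d & forall z, `|z| < d -> `|expR z - 1| < eps.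
  have /cvgrPdist_lt/(_ _ e0)[d d0 hd] := @continuous_expR R 0.
  exists d => // z zd; have := hd z; rewrite /= sub0r normrN expR0 distrC.
  by apply.
(* The bound 1 keeps [ln x - ln s] in the range [0, 1] of the uniform estimate. The other bound
   makes the linear term at most [d / 2], with [+ 1] guarding against [alpha = 0]. *)
pose c := Num.min 1 (d / 2 / (`|alpha| + 1)).
have a0 : 0 < `|alpha| + 1 by rewrite ltr_wpDl.
have c0 : 0 < c by rewrite lt_min ltr01/= !divr_gt0.
have c1 : c <= 1 by rewrite ge_min lexx.
have cd : c * (`|alpha| + 1) <= d / 2.
  by rewrite -ler_pdivlMr// ge_min lexx orbT.
exists (expR (- c)); first by rewrite expR_gt0/= expR_lt1 oppr_lt0.
have d20 : 0 < d / 2 by rewrite divr_gt0.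
have [M [_ hM]] :=
  uniform_convergence_slowly_varying measurable_logg logg_slow d20.
have [M' [_ hM']] := gpos.
near=> x => s /andP[xs sx].
have x0 : 0 < x by near: x; exact: nbhs_pinfty_gt (num_real _).
have s0 : 0 < s by apply: lt_le_trans xs; rewrite mulr_gt0 ?expR_gt0.
have sM' : M' < s.
  apply: lt_le_trans xs; rewrite mulrC expRN ltr_pdivlMr ?expR_gt0//.
  by near: x; exact: nbhs_pinfty_gt (num_real _).
have gs : 0 < g s by exact: hM'.
have gx : 0 < g x by apply: hM'; exact: lt_le_trans sx.
pose y := ln x - ln s.
have y0 : 0 <= y by rewrite subr_ge0 ler_ln ?posrE.
have yc : y <= c.
  have : ln (expR (- c) * x) <= ln s by rewrite ler_ln ?posrE// mulr_gt0 ?expR_gt0.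
  by rewrite lnM ?posrE ?expR_gt0// expRK /y; lra.
have sM : M < ln s.
  have : M + 1 < ln x.
    have xM : expR (M + 1) < x by near: x; exact: nbhs_pinfty_gt (num_real _).
    by rewrite -[M + 1]expRK ltr_ln ?posrE ?expR_gt0.
  by move: yc; rewrite /y; lra.
have : `|logg (ln s + y) - logg (ln s)| < d / 2.
  by apply: hM => //; rewrite y0 (le_trans yc).
rewrite /logg (_ : ln s + y = ln x); last by rewrite /y; lra.
rewrite !lnK ?posrE// => hlog.
have lnb : `|ln (g s / g x)| < d.
  rewrite ln_div ?posrE//.
  have : `|alpha * y| <= d / 2.
    rewrite normrM (ger0_norm y0) mulrC; apply: le_trans cd.
    by apply: ler_pM => //; rewrite lerDl.
  move: hlog; rewrite !ltr_norml ler_norml /y => /andP[p1 p2] /andP[p3 p4].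
  by apply/andP; split; lra.
by have := hd _ lnb; rewrite lnK// posrE divr_gt0.
Unshelve. all: by end_near.
Qed.
End regular_variation.

(** * Convergence in distribution from survival functions *)

(** An open set is the union of the countably many balls with rational centre and radius [1 / k.+1]
    that it contains. A ball of row vectors is a box, so its preimage involves the coordinates only,
    and no sigma-algebra on row vectors is required. *)
Lemma measurable_continuous_rV (d : measure_display) (T : measurableType d)
    (R : realType) (n : nat) (f : 'rV[R]_n -> R) (V : T -> 'rV[R]_n) :
  continuous f -> (forall i, measurable_fun setT (fun w => V w ord0 i)) ->
  measurable_fun setT (f \o V).
Proof.
move=> cf mV; apply: (measurability _ (RGenOInfty.measurableE R)).
move=> _ [_ [a ->] <-]; rewrite setTI.
have oU : open (f @^-1` `]a, +oo[) by apply: open_comp => // x _; exact: cf.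
set U := f @^-1` _ in oU.
pose box (ck : 'rV[rat]_n * nat) : set 'rV[R]_n :=
  ball (map_mx ratr ck.1 : 'rV[R]_n) (ck.2.+1%:R^-1 : R).
pose F ck : set T := if pselect (box ck `<=` U) is left _ then V @^-1` box ck
  else set0.
rewrite comp_preimage -/U (_ : V @^-1` U = \bigcup_ck F ck); last first.
  apply/seteqP; split=> [w Uw|w [ck _]]; last first.
    by rewrite /F; case: pselect => // sub /sub.
  have /(open_nbhs_nbhs) : open_nbhs (V w) U by [].
  rewrite -nbhs_ballE => -[e /= e0 eU].
  have [k /= ke] : exists k : nat, k.+1%:R^-1 < e / 2.
    have := near_infty_natSinv_lt (PosNum (divr_gt0 e0 (ltr0n R 2))).
    by case=> N _ hN; exists N; exact: (hN N (leqnn N)).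
  have hq (i : 'I_n) : exists q : rat, `|ratr q - V w ord0 i| < k.+1%:R^-1.
    have [|q] := @rat_in_itvoo R (V w ord0 i - k.+1%:R^-1) (V w ord0 i + k.+1%:R^-1).
      by rewrite ltrD2l gtrN// invr_gt0.
    rewrite in_itv/= => hq; exists q.
    by rewrite ltr_distl.
  have [q hqi] := choice hq.
  exists (\row_i q i, k) => //; rewrite /F.
  have qV : box (\row_i q i, k) (V w).
    by split; rewrite ?invr_gt0// => i j; rewrite !mxE /ball/= ord1; exact: hqi.
  case: pselect => // nU; exfalso; apply: nU => z bz; apply: eU.
  apply: (@le_ball _ _ _ (k.+1%:R^-1 + k.+1%:R^-1)).
    by rewrite [leRHS]splitr ltW// ltrD.
  by apply: ball_triangle bz; exact: ball_sym.
apply: countable_bigcupT_measurable => [|ck]; first exact: countableP.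
rewrite /F; case: pselect => // _.
rewrite (_ : _ @^-1` _ = \bigcap_(i in [set: 'I_n])
   ((fun w => V w ord0 i) @^-1` ball (ratr (ck.1 ord0 i) : R) (ck.2.+1%:R^-1 : R))).
  apply: fin_bigcap_measurable => [//|i _]; rewrite -[X in measurable X]setTI.
  by apply: mV => //; exact: measurable_ball.
apply/seteqP; split => w /=.
  by move=> [_ h] i _; have := h ord0 i; rewrite mxE.
move=> h; split; first by rewrite invr_gt0.
by move=> i j; rewrite mxE ord1; exact: h.
Qed.

(** This is the Heine-Cantor theorem with [y] free to leave [A]. Compactness enters as the
    near-covering property along radii tending to 0 from the right. *)
Lemma compact_uniform_continuity (R : realType) (n : nat) (f : 'rV[R]_n -> R)
    (A : set 'rV[R]_n) (eps : R) :
  continuous f -> compact A -> 0 < eps ->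
  exists2 e : R, 0 < e & forall x y, A x -> ball x e y -> `|f x - f y| < eps.
Proof.
move=> cf /compact_near_coveringP cA e0.
have := cA R (0^'+) (fun e x => forall y, ball x e y -> `|f x - f y| < eps) _.
case.
  move=> x _; have e20 : 0 < eps / 2 by rewrite divr_gt0.
  have /cvgrPdist_lt/(_ _ e20) := cf x.
  rewrite /prop_near1 -nbhs_ballE => -[r /= r0 hr].
  exists (ball x (r / 2), [set z | 0 < z < r / 2]).
    split => /=; first by apply: nbhsx_ballx; rewrite divr_gt0.
    exists (r / 2) => /=; first by rewrite divr_gt0.
    move=> z /=; rewrite sub0r normrN => zr z0.
    by rewrite z0 (le_lt_trans (ler_norm _)).
  move=> [x' e] /= [xx' /andP[e_gt0 er]] y x'y.
  have h1 : `|f x - f x'| < eps / 2.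
    by apply: hr; apply: le_ball xx'; rewrite ler_pdivrMr// ler_peMr ?ltW// ltr1n.
  have h2 : `|f x - f y| < eps / 2.
    apply: hr; rewrite [r]splitr; apply: ball_triangle xx' _.
    by apply: le_ball x'y; exact: ltW.
  rewrite (_ : f x' - f y = (f x - f y) - (f x - f x')); last by lra.
  by rewrite [eps]splitr (le_lt_trans (ler_normB _ _))// ltrD.
move=> r /= r0 hr; exists (r / 2); first by rewrite divr_gt0.
move=> x y Ax; apply: hr => //=; last by rewrite divr_gt0.
by rewrite sub0r normrN gtr0_norm ?divr_gt0// ltr_pdivrMr// ltr_pMr// ltr1n.
Qed.
(** Half-open sides make grid cells tile without overlap. They also match differences of the strict
    events [s i < V w ord0 i]. *)
Definition half_open_box (R : realType) (n : nat) (a b : 'I_n -> R) : set 'rV[R]_n :=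
  [set z | forall i, a i < z ord0 i <= b i].

Lemma unit_cell_index (R : realType) (m : nat) (x : R) : 0 < x <= m%:R ->
  exists j : 'I_m, j%:R < x <= j.+1%:R.
Proof.
elim: m => [|m ih]; first by case/andP => x0 /(lt_le_trans x0); rewrite ltxx.
move=> /andP[x0 xm]; have [xm'|mx] := leP x m%:R.
  have [|j hj] := ih; first by rewrite x0.
  by exists (widen_ord (leqnSn m) j).
by exists ord_max; rewrite /= mx.
Qed.

Lemma unit_cell_index_uniq (R : realType) (i j : nat) (x : R) :
  i%:R < x <= i.+1%:R -> j%:R < x <= j.+1%:R -> i = j.
Proof.
move=> /andP[ix xi] /andP[jx xj]; apply/eqP; rewrite eqn_leq.
rewrite -ltnS -(ltr_nat R) (lt_le_trans ix)//=.
by rewrite -ltnS -(ltr_nat R) (lt_le_trans jx).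
Qed.

(** The cube of side [K] is cut into cells of side [1 / N.+1], finer than the modulus of continuity,
    and [f] is frozen at the upper corner of each cell. Outside the cube the step function is 0,
    which costs at most [M]. *)
Lemma step_function_approximation (R : realType) (n : nat) (f : 'rV[R]_n -> R)
    (M eps : R) (K : nat) :
  continuous f -> (forall x, `|f x| <= M) -> 0 < eps ->
  exists (I : finType) (a b : I -> 'I_n -> R) (v : I -> R),
    (forall c i, 0 <= a c i <= b c i) /\
    (forall z, `|f z - \sum_c v c * \1_(half_open_box (a c) (b c)) z| <=
       eps + M * (1 - \1_(half_open_box (fun=> 0) (fun=> K%:R)) z)).
Proof.
move=> cf fM e0.
have cA : compact [set z : 'rV[R]_n | forall i, z ord0 i \in `[0, K%:R]].
  apply: (@rV_compact R n (fun=> [set` `[(0 : R), K%:R]])) => _.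
  exact: segment_compact.
have [e r0 hr] := compact_uniform_continuity cf cA e0.
have [N Ne] : exists N : nat, N.+1%:R^-1 < e.
  have := near_infty_natSinv_lt (PosNum r0).
  by case=> N _ hN; exists N; exact: (hN N (leqnn N)).
have N0 : (0 : R) < N.+1%:R by rewrite ltr0n.
pose a (c : {ffun 'I_n -> 'I_(K * N.+1)}) i : R := (c i)%:R / N.+1%:R.
pose b (c : {ffun 'I_n -> 'I_(K * N.+1)}) i : R := (c i).+1%:R / N.+1%:R.
pose v (c : {ffun 'I_n -> 'I_(K * N.+1)}) := f (\row_i b c i).
have cellE c z : half_open_box (a c) (b c) z <->
    forall i, (c i)%:R < z ord0 i * N.+1%:R <= (c i).+1%:R.
  by split => h i; have := h i; rewrite /a /b ltr_pdivrMr// ler_pdivlMr.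
exists _, a, b, v; split.
  by move=> c i; rewrite divr_ge0//= ler_pM2r ?invr_gt0// ler_nat.
move=> z; have [zK|nzK] := pselect (half_open_box (fun=> 0) (fun=> K%:R) z).
  have hc i : exists j : 'I_(K * N.+1), j%:R < z ord0 i * N.+1%:R <= j.+1%:R.
    have /andP[z0 zKi] := zK i; apply: unit_cell_index.
    by rewrite natrM mulr_gt0//= ler_pM2r.
  have [c' hc'] := choice hc; pose c := [ffun i => c' i].
  have zc : half_open_box (a c) (b c) z by apply/cellE => i; rewrite ffunE.
  rewrite (bigD1 c)//= big1 ?addr0.
    rewrite !indicE (mem_set zK) (mem_set zc) subrr mulr0 addr0 mulr1 ltW//.
    apply: hr => [i|] /=.
      by have /andP[z0 z1] := zK i; rewrite in_itv/= ltW.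
    split => // j i; rewrite ord1 mxE /ball/=.
    have /andP[z0 z1] := zc i; rewrite distrC ger0_norm ?subr_ge0//.
    have bE : b c i = a c i + N.+1%:R^-1 by rewrite /a /b -natr1 mulrDl mul1r.
    by apply: le_lt_trans Ne; rewrite bE lerBlDr addrC lerD2l ltW.
  move=> d /negP dc; rewrite indicE memNset ?mulr0// => /cellE zd; apply: dc.
  apply/eqP/ffunP => i; apply/val_inj => /=.
  by apply: unit_cell_index_uniq (zd i) _; rewrite ffunE; exact: hc'.
rewrite [X in _ - X]big1 => [|c _].
  by rewrite indicE memNset// !subr0 mulr1 (le_trans (fM z))// lerDr ltW.
rewrite indicE memNset ?mulr0// => /cellE zc; apply: nzK => i.
have /andP[z0 z1] := zc i; apply/andP; split.
  by rewrite -(pmulr_lgt0 _ N0) (le_lt_trans _ z0).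
by rewrite -(ler_pM2r N0) (le_trans z1)// -natrM ler_nat.
Qed.

Section expectation_of_step.
Context (d : measure_display) (T : measurableType d) (R : realType)
  (P : probability T R) (n : nat) (V : T -> 'rV[R]_n).
Hypothesis mV : forall i, measurable_fun setT (fun w => V w ord0 i).

Lemma measurable_half_open_box (a b : 'I_n -> R) :
  measurable (V @^-1` half_open_box a b).
Proof.
rewrite (_ : _ @^-1` _ = \bigcap_(i in [set: 'I_n])
   ((fun w => V w ord0 i) @^-1` [set` `]a i, b i]])); last first.
  apply/seteqP; split => w /= h i; first by move=> _; rewrite /= in_itv/=.
  by have := h i Logic.I; rewrite /= in_itv.
apply: fin_bigcap_measurable => // i _; rewrite -[X in measurable X]setTI.
by apply: mV => //; exact: measurable_itv.
Qed.

Lemma bounded_integrable (f : T -> R) (M : R) : measurable_fun setT f ->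
  (forall w, `|f w| <= M) -> P.-integrable setT (EFin \o f).
Proof.
move=> mf fM; apply: measurable_bounded_integrable => //.
  by rewrite (le_lt_trans (probability_le1 P measurableT)) ?ltry.
exists M; split; first exact: num_real.
by move=> y My w _; exact: le_trans (fM w) (ltW My).
Qed.

Lemma expectation_step_approximation (f : 'rV[R]_n -> R) (M eps : R)
    (I : finType) (a b : I -> 'I_n -> R) (v : I -> R) (B : set 'rV[R]_n) :
  continuous f -> (forall x, `|f x| <= M) -> measurable (V @^-1` B) ->
  (forall z, `|f z - \sum_c v c * \1_(half_open_box (a c) (b c)) z| <=
       eps + M * (1 - \1_B z)) ->
  `| fine ('E_P[f \o V])%E -
     \sum_c v c * fine (P (V @^-1` half_open_box (a c) (b c)))| <=
  eps + M * (1 - fine (P (V @^-1` B))).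
Proof.
move=> cf fM mB hf; rewrite unlock -[fine _]/(\int[P]_w (f \o V) w).
pose C c := V @^-1` half_open_box (a c) (b c).
have mC c : measurable (C c) by exact: measurable_half_open_box.
have iF : P.-integrable setT (EFin \o (f \o V)).
  apply: (@bounded_integrable _ M) => [|w]; last exact: fM.
  exact: measurable_continuous_rV.
have iC (A : set T) (r : R) : measurable A ->
    P.-integrable setT (EFin \o (fun w => r * \1_A w)).
  move=> mA; apply: (@integrableZl _ _ _ P setT measurableT r (EFin \o \1_A)).
  exact: integrable_indic.
have iG : P.-integrable setT (EFin \o (fun w => \sum_c v c * \1_(C c) w)).
  rewrite (_ : _ \o _ = fun w => (\sum_c (v c * \1_(C c) w)%:E)%E); last first.
    by apply/funext => w /=; rewrite sumEFin.
  by apply: integrable_sum => // c _; exact: iC.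
have GE : \int[P]_w (\sum_c v c * \1_(C c) w) = \sum_c v c * fine (P (C c)).
  rewrite /Rintegral; under eq_integral do rewrite -sumEFin.
  rewrite integral_sum//; last by move=> c; exact: iC.
  rewrite -sum_fine; last by move=> c _; apply: integrable_fin_num => //; exact: iC.
  apply: eq_bigr => c _; rewrite -[LHS]/(\int[P]_w (v c * \1_(C c) w)).
  rewrite RintegralZl//; last exact: integrable_indic.
  by rewrite /Rintegral integral_indic// setIT.
rewrite -GE -RintegralB//.
have iFG : P.-integrable setT (EFin \o (fun w => f (V w) - \sum_c v c * \1_(C c) w)).
  exact: (integrableB measurableT iF iG).
apply: le_trans (le_normr_Rintegral measurableT iFG) _.
have iB : P.-integrable setT (EFin \o \1_(V @^-1` B)) by exact: integrable_indic.
have i1 : P.-integrable setT (EFin \o (cst (1 : R))).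
  exact: finite_measure_integrable_cst.
have -> : eps + M * (1 - fine (P (V @^-1` B))) =
    \int[P]_w ((eps + M) * cst 1 w - M * \1_(V @^-1` B) w).
  rewrite RintegralB//; last 2 first.
  - exact: (integrableZl measurableT _ i1).
  - exact: iC.
  have e1 : \int[P]_w (cst (1 : R) w) = 1.
    transitivity (1 * fine (P setT)); first exact: Rintegral_cst.
    by rewrite probability_setT mulr1.
  have eB : \int[P]_w (\1_(V @^-1` B) w) = fine (P (V @^-1` B)).
    by rewrite /Rintegral integral_indic// setIT.
  by rewrite !RintegralZl// e1 eB; lra.
apply: le_Rintegral => //.
- exact: (integrable_norm iFG).
- exact: (integrableB measurableT (integrableZl measurableT _ i1) (iC _ M mB)).
- move=> w _; apply: le_trans (hf (V w)) _.
  rewrite /= [\1_(V @^-1` B) w]indicE [\1_B _]indicE.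
  rewrite (_ : (w \in _) = (V w \in B)); first lra.
  by apply/idP/idP; rewrite !inE.
Qed.

End expectation_of_step.

Lemma cvg_sumr (R : realType) (T : Type) (F : set_system T) (I : Type)
    (r : seq I) (f : I -> T -> R) (l : I -> R) : Filter F ->
  (forall i, f i x @[x --> F] --> l i) ->
  (\sum_(i <- r) f i x) @[x --> F] --> \sum_(i <- r) l i.
Proof.
move=> FF fl; elim: r => [|i r ih].
  by rewrite big_nil; under eq_fun do rewrite big_nil; exact: cvg_cst.
rewrite big_cons; under eq_fun do rewrite big_cons.
by apply: cvgD => //; exact: fl.
Qed.

Definition survival_event (T : Type) (R : realType) (n : nat)
    (V : T -> 'rV[R]_n) (s : 'I_n -> R) : set T :=
  [set w | forall i, s i < V w ord0 i].

Section survival_to_boxes.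
Context (R : realType) (n : nat).

(* Only the first [m] coordinates are bounded above: [m = 0] is a survival event
   and [m = n] a box. *)
Let partial_box (T : Type) (V : T -> 'rV[R]_n) (m : nat) (a b : 'I_n -> R) : set T :=
  [set w | forall i, a i < V w ord0 i /\ ((i < m)%N -> V w ord0 i <= b i)].

Let measurable_partial_box (d : measure_display) (T : measurableType d)
    (V : T -> 'rV[R]_n) m a b :
  (forall i, measurable_fun setT (fun w => V w ord0 i)) ->
  measurable (partial_box V m a b).
Proof.
move=> mV.
rewrite (_ : partial_box V m a b = \bigcap_(i in [set: 'I_n])
   ((fun w => V w ord0 i) @^-1`
     (if (i < m)%N then [set` `]a i, b i]] else [set` `]a i, +oo[]))); last first.
  apply/seteqP; split => w h i.
    move=> _; have [h1 h2] := h i; case: ifPn => im; rewrite /= in_itv/= h1//=.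
    exact: h2.
  have := h i Logic.I; case: ifPn => im; rewrite /= in_itv/= ?andbT => hi //.
  by case/andP: hi.
apply: fin_bigcap_measurable => // i _; rewrite -[X in measurable X]setTI.
by apply: mV => //; case: ifPn => _; exact: measurable_itv.
Qed.

(** This is inclusion-exclusion, one coordinate at a time: bounding coordinate [m] above by [b]
    removes the part where it exceeds [b], which is the same kind of set with that lower corner
    raised to [b]. *)
Let partial_box_step (d : measure_display) (T : measurableType d)
    (P : probability T R) (V : T -> 'rV[R]_n) m (mn : (m < n)%N) a b :
  (forall i, measurable_fun setT (fun w => V w ord0 i)) ->
  (forall i, a i <= b i) ->
  fine (P (partial_box V m.+1 a b)) = fine (P (partial_box V m a b)) -
    fine (P (partial_box V m
       (fun i => if i == Ordinal mn then b i else a i) b)).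
Proof.
move=> mV ab; set a' := fun i => _.
have aa' i : a i <= a' i by rewrite /a'; case: ifP.
rewrite (_ : partial_box V m.+1 a b =
    partial_box V m a b `\` partial_box V m a' b); last first.
  apply/seteqP; split => w.
    move=> h; split.
      by move=> i; have [h1 h2] := h i; split => // im; apply: h2; exact: ltnW.
    move=> h'; have [_ h2] := h (Ordinal mn); have [h3 _] := h' (Ordinal mn).
    by move: h3; rewrite /a' eqxx ltNge h2//= ltnSn.
  move=> [h h'] i; have [h1 h2] := h i; split => //; rewrite ltnS leq_eqVlt.
  move=> /orP[/eqP im|]; last exact: h2.
  rewrite leNgt; apply/negP => bV; apply: h' => j.
  have [h3 h4] := h j; split => //; rewrite /a'; case: eqP => // ->.
  by have <- : i = Ordinal mn by exact: val_inj.
rewrite measureD//=;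
  [|exact: measurable_partial_box|exact: measurable_partial_box|]; last first.
  by rewrite (le_lt_trans (probability_le1 P _)) ?ltry//; exact: measurable_partial_box.
rewrite fineB ?fin_num_measure//; first 1 last.
- exact: measurable_partial_box.
- by apply: measurableI; exact: measurable_partial_box.
congr (_ - fine (P _)); apply/setIidPr => w h i.
by have [h1 h2] := h i; split => //; exact: le_lt_trans h1.
Qed.

Context (d d' : measure_display) (T : measurableType d) (T' : measurableType d')
  (P : probability T R) (P' : probability T' R)
  (V : R -> T -> 'rV[R]_n) (Z : T' -> 'rV[R]_n).
Hypothesis mV : forall t i, measurable_fun setT (fun w => V t w ord0 i).
Hypothesis mZ : forall i, measurable_fun setT (fun w => Z w ord0 i).
Hypothesis survival_cvg : forall s : 'I_n -> R, (forall i, 0 <= s i) ->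
  fine (P (survival_event (V t) s)) @[t --> +oo] -->
  fine (P' (survival_event Z s)).

Lemma half_open_box_cvg (a b : 'I_n -> R) : (forall i, 0 <= a i <= b i) ->
  fine (P (V t @^-1` half_open_box a b)) @[t --> +oo] -->
  fine (P' (Z @^-1` half_open_box a b)).
Proof.
move=> ab.
have boxE (S : Type) (W : S -> 'rV[R]_n) :
    W @^-1` half_open_box a b = partial_box W n a b.
  apply/seteqP; split => w h i; first by have /andP[] := h i.
  by have [-> ->] := h i.
(* The induction quantifies over the lower corner, since [partial_box_step] changes it. *)
suff H m : (m <= n)%N -> forall a, (forall i, 0 <= a i <= b i) ->
    fine (P (partial_box (V t) m a b)) @[t --> +oo] -->
    fine (P' (partial_box Z m a b)).
  by rewrite boxE; under eq_fun do rewrite boxE; exact: H.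
clear boxE; elim: m => [_|m ih mn] {ab}a ab.
  have survE (S : Type) (W : S -> 'rV[R]_n) :
      partial_box W 0 a b = survival_event W a.
    by apply/seteqP; split => w h i; have := h i => // -[].
  rewrite survE; under eq_fun do rewrite survE.
  by apply: survival_cvg => i; have /andP[] := ab i.
have ab' i : a i <= b i by have /andP[] := ab i.
rewrite (partial_box_step P' mn mZ ab').
under eq_fun => t do rewrite (partial_box_step P mn (mV t) ab').
apply: cvgB; first exact: (ih (ltnW mn)).
apply: (ih (ltnW mn)) => i; have := ab i; case: ifP => _ // /andP[a0 a_le_b].
by rewrite lexx (le_trans a0).
Qed.

(** The hypothesis at threshold 0 says that the limit lives in the open positive orthant, so some
    cube []0, K]^n] carries almost all its mass. Convergence on that cube transfers this to [V t],
    and the test function is replaced by a step function there. *)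
Lemma cvg_in_distribution_survival :
  P' (survival_event Z (fun=> 0)) = 1%E -> cvg_in_distribution P P' V Z.
Proof.
move=> Z0 f cf [M fM].
have M0 : 0 <= M by apply: le_trans (fM 0).
have fin (d0 : measure_display) (S : measurableType d0) (Q : probability S R)
    (W : S -> 'rV[R]_n) : (forall i, measurable_fun setT (fun w => W w ord0 i)) ->
    ('E_Q[f \o W] \is a fin_num)%E.
  move=> mW; rewrite unlock; apply: integrable_fin_num => //.
  apply: (@bounded_integrable _ _ _ _ _ M) => [|w]; last exact: fM.
  exact: measurable_continuous_rV.
rewrite -(fineK (fin _ _ P' _ mZ)).
apply/fine_cvgP; split; first by apply: nearW => t; exact: fin.
apply/cvgrPdist_le => e e0.
(* Two sixths pay for [Z] (step error and mass outside the cube), three for [V t] (the same two and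
   the difference of the cube's probabilities), and one for the difference of the step expectations.
   Dividing by [M + 1] covers [M = 0]. *)
have e6 : 0 < e / 6 by rewrite divr_gt0.
have eM : 0 < e / 6 / (M + 1) by rewrite divr_gt0// ltr_wpDl.
have Me (x : R) : x <= e / 6 / (M + 1) -> M * x <= e / 6.
  move=> xe; apply: le_trans (_ : (M + 1) * (e / 6 / (M + 1)) <= _); last first.
    by rewrite mulrC divfK// gt_eqF// ltr_wpDl.
  apply: le_trans (ler_wpM2l M0 xe) _.
  by apply: ler_wpM2r; [exact: ltW|rewrite lerDl].
have [K hK] : exists K : nat,
    1 - fine (P' (Z @^-1` half_open_box (fun=> 0) (fun=> K%:R))) <= e / 6 / (M + 1).
  have cv : P' (Z @^-1` half_open_box (fun=> 0) (fun=> k%:R)) @[k --> \oo] --> 1%E.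
    have <- : P' (\bigcup_k (Z @^-1` half_open_box (fun=> 0) (fun=> k%:R))) = 1%E.
      rewrite -Z0; congr (P' _); apply/seteqP; split => w.
        by move=> [k _ h] i; have /andP[] := h i.
      move=> h; exists (\max_i (Num.truncn (Z w ord0 i)).+1)%N => // i; rewrite h/=.
      apply: (le_trans (ltW (truncnS_gt _))); rewrite ler_nat.
      exact: (leq_bigmax (F := fun i => (Num.truncn (Z w ord0 i)).+1)).
    apply: nondecreasing_cvg_mu => //.
    - by move=> k; exact: measurable_half_open_box.
    - by apply: bigcupT_measurable => k; exact: measurable_half_open_box.
    - move=> k l kl; apply/subsetPset => w h i; have /andP[-> h2] := h i.
      by rewrite (le_trans h2)// ler_nat.
  have /fine_cvgP[_ /cvgrPdist_le/(_ _ eM)[K _ hK]] := cv.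
  have {}hK := hK K (leqnn K).
  by exists K; apply: le_trans hK; exact: ler_norm.
have [I [a [b [v [ab hf]]]]] := step_function_approximation K cf fM e6.
have cvB : fine (P (V t @^-1` half_open_box (fun=> 0) (fun=> K%:R))) @[t --> +oo] -->
    fine (P' (Z @^-1` half_open_box (fun=> 0) (fun=> K%:R))).
  by apply: half_open_box_cvg => i; rewrite lexx/=.
have cvS : \sum_c v c * fine (P (V t @^-1` half_open_box (a c) (b c))) @[t --> +oo] -->
    \sum_c v c * fine (P' (Z @^-1` half_open_box (a c) (b c))).
  apply: cvg_sumr => c; apply: cvgM; first exact: cvg_cst.
  exact: half_open_box_cvg.
have hZ := expectation_step_approximation P' mZ cf fM
  (measurable_half_open_box mZ _ _) hf.
have /cvgrPdist_le/(_ _ eM) hB0 := cvB.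
have /cvgrPdist_le/(_ _ e6) hS0 := cvS.
near=> t.
have hV := expectation_step_approximation P (mV t) cf fM
  (measurable_half_open_box (mV t) _ _) hf.
have hB : `|fine (P' (Z @^-1` half_open_box (fun=> 0) (fun=> K%:R))) -
   fine (P (V t @^-1` half_open_box (fun=> 0) (fun=> K%:R)))| <= e / 6 / (M + 1).
  by near: t; exact: hB0.
have hS : `|\sum_c v c * fine (P' (Z @^-1` half_open_box (a c) (b c))) -
   \sum_c v c * fine (P (V t @^-1` half_open_box (a c) (b c)))| <= e / 6.
  by near: t; exact: hS0.
have := Me _ hK; have := Me _ (le_trans (ler_norm _) hB).
move: hV hZ hS; rewrite /= !ler_norml.
set pV := fine (P _); set pZ := fine (P' _); set SV := \sum_c _; set SZ := \sum_c _.
set EV := fine _; set EZ := fine _.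
move=> /andP[? ?] /andP[? ?] /andP[? ?]; rewrite !mulrBr !mulr1 => ? ?.
by apply/andP; split; lra.
Unshelve. all: by end_near.
Qed.
End survival_to_boxes.

(** * The inverse of the extremal process *)

Section extremal_intensity_of_rectangles.
Context (R : realType).
Local Notation mu := (@lebesgue_measure R).

Lemma integral_expN2_itvoy (u : R) : 0 < u ->
  (\int[mu]_(y in `]u, +oo[) (y ^- 2)%:E = (u^-1)%:E)%E.
Proof.
move=> u0.
have neq0 y : u <= y -> y != 0 by move=> /(lt_le_trans u0); rewrite lt0r => /andP[].
have cf : {within `[u, +oo[, continuous (fun y : R => y ^- 2)}.
  apply: continuous_in_subspaceT => y; rewrite inE/= in_itv/= andbT => uy.
  apply: cvgV; first by rewrite expf_neq0// neq0.
  exact: exprn_continuous.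
rewrite integral_itv_obnd_cbnd; last first.
  apply/measurable_EFinP; apply: subspace_continuous_measurable_fun => //.
  apply: continuous_subspaceW cf => y /=; rewrite !in_itv/= !andbT; exact: ltW.
rewrite (@ge0_continuous_FTC2y _ _ (fun y => - y^-1) _ 0).
- by rewrite sub0e EFinN oppeK.
- by move=> y uy; rewrite invr_ge0 exprn_ge0// ltW// (lt_le_trans u0).
- exact: cf.
- apply/cvgrPdist_le => e e0; near=> y.
  have ye : e^-1 < y by near: y; exact: nbhs_pinfty_gt (num_real _).
  have y0 : 0 < y by apply: lt_trans ye; rewrite invr_gt0.
  rewrite sub0r opprK gtr0_norm ?invr_gt0// -[leRHS]invrK.
  by rewrite lef_pV2 ?posrE ?invr_gt0// ltW.
- move=> y uy; apply: derivableN; apply: derivableV => //.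
  by rewrite neq0// ltW.
- apply: cvgN; apply: cvgV; first exact: neq0.
  exact/cvg_at_right_filter/cvg_id.
- move=> y; rewrite in_itv/= andbT => uy.
  rewrite derive1E deriveN; last by apply: derivableV => //; rewrite neq0// ltW.
  rewrite deriveV//; last by rewrite neq0// ltW.
  by rewrite derive_id scaleNr opprK /GRing.scale/= mulr1.
Unshelve. all: by end_near.
Qed.

Lemma extremal_intensity_rectangle (D : set R) (u : R) : measurable D ->
  D `<=` `[0, +oo[ -> 0 < u ->
  extremal_intensity [set p : R * \bar R | D p.1 /\ (u%:E < p.2)%E] =
  (mu D * (u^-1)%:E)%E.
Proof.
move=> mD D0 u0; set A := [set p | _]; rewrite /extremal_intensity.
have inner (t : R) : (\int[mu]_(y in `]0%R, +oo[) (\1_A (t, y%:E) * y ^- 2)%:E =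
    (\1_D t * u^-1)%:E)%E.
  have [Dt|nDt] := pselect (D t).
    rewrite [in RHS]indicE mem_set// mul1r -integral_expN2_itvoy//.
    have -> : `]u, +oo[%classic = `]0, +oo[ `&` `]u, +oo[ :> set R.
      apply/seteqP; split => y /=; rewrite !in_itv/= !andbT; last by case.
      by move=> uy; split => //; exact: lt_trans uy.
    rewrite integral_mkcondr; apply: eq_integral => y y0.
    rewrite patchE indicE; case: ifPn => yu.
      rewrite mem_set ?mul1r// /A/=; split => //.
      by move: yu; rewrite inE/= in_itv/= andbT lte_fin.
    rewrite memNset ?mul0r// => -[_ /=]; rewrite lte_fin => uy.
    by move/negP: yu; apply; rewrite inE/= in_itv/= uy.
  rewrite [in RHS]indicE memNset// mul0r; apply: integral0_eq => y _.
  by rewrite indicE memNset ?mul0r// => -[].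
under eq_integral do rewrite inner EFinM.
rewrite ge0_integralZr//=; last 2 first.
- by apply/measurable_EFinP; exact: measurable_indic.
- by rewrite lee_fin invr_ge0 ltW.
by rewrite integral_indic// setIidl.
Qed.

End extremal_intensity_of_rectangles.

(* [extremal_process (s i) <= u i] for all [i] iff the staircase
   [\bigcup_i [0, s i] * ]u i, +oo]] contains no point; as [u] increases, the
   staircase splits into the rectangles over [first_level s j], whose lengths
   are the numerators in [staircase_mass]. *)
Section staircase.
Context (R : realType) (n : nat) (u s : 'I_n -> R).

Definition previous_max (j : 'I_n) : R := \big[Num.max/0]_(i < n | (i < j)%N) s i.

Definition staircase_mass : R :=
  \sum_j Num.max 0 (s j - previous_max j) / u j.

Definition first_level (j : 'I_n) : set R :=
  [set t | [/\ 0 <= t, t <= s j & forall i : 'I_n, (i < j)%N -> s i < t]].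

(** The witness is the least index [j] with [t <= s j]. The bound [j <= i] matters: a point above
    [u i] is then also above the lower level [u j]. *)
Lemma first_level_exists (t : R) (i : 'I_n) : 0 <= t -> t <= s i ->
  exists2 j : 'I_n, (j <= i)%N & first_level j t.
Proof.
move=> t0; move: {2}(i : nat) (leqnn i) => m.
elim: m i => [|m ih] i im ti.
  exists i => //; split => // k; move: im; rewrite leqn0 => /eqP ->.
  by rewrite ltn0.
have [[k [ki tk]]|nk] := pselect (exists k : 'I_n, (k < i)%N /\ t <= s k).
  have [|j jk jt] := ih k _ tk; first by rewrite -ltnS (leq_trans ki).
  by exists j => //; rewrite (leq_trans jk)// ltnW.
exists i => //; split => // k ki; rewrite ltNge; apply/negP => tk.
by apply: nk; exists k.
Qed.

Lemma trivIset_first_level : trivIset setT first_level.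
Proof.
move=> i j _ _ [t [[t0 ti hi] [_ tj hj]]].
apply/eqP; case: (ltngtP i j) => [ij|ji|/val_inj->//].
  by have := hj _ ij; rewrite ltNge ti.
by have := hi _ ji; rewrite ltNge tj.
Qed.

Lemma first_level_measure (j : 'I_n) :
  measurable (first_level j) /\
  lebesgue_measure (first_level j) = (Num.max 0 (s j - previous_max j))%:E.
Proof.
have ge0 : 0 <= previous_max j by apply: bigmax_ge_id.
have mD : measurable (first_level j).
  rewrite (_ : first_level j = `[0, s j] `&`
      \bigcap_(i in [set i : 'I_n | (i < j)%N]) `]s i, +oo[%classic).
    apply: measurableI => //.
    by apply: fin_bigcap_measurable => // i _; exact: measurable_itv.
  apply/seteqP; split => t.
    move=> [t0 tj h]; split; first by rewrite /= in_itv/= t0.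
    by move=> i ij; rewrite /= in_itv/= h.
  rewrite /= in_itv/= => -[/andP[t0 tj] h]; split => // i ij.
  by have := h i ij; rewrite /= in_itv/= andbT.
have lenE (p q : R) : (if (p%:E < q%:E)%E then q%:E - p%:E else 0)%E =
    (Num.max 0 (q - p))%:E :> \bar R.
  rewrite lte_fin; case: (ltP p q) => pq.
    by rewrite max_r// subr_ge0 ltW.
  by rewrite max_l// subr_le0.
(* [first_level s j] is squeezed between the half-open and the closed interval from
   [previous_max s j] to [s j]. Neither is always equal to it, since time 0 may or may not belong to
   it, but their lengths agree. *)
split => //; apply/eqP; rewrite eq_le; apply/andP; split.
  have -> : (Num.max 0 (s j - previous_max j))%:E =
      lebesgue_measure `[previous_max j, s j].
    by rewrite lebesgue_measure_itv/= lenE.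
  apply: le_measure; rewrite ?inE//.
  move=> t [t0 tj h]; rewrite /= in_itv/= tj andbT; apply/bigmax_leP; split => // i ij.
  by rewrite ltW// h.
have -> : (Num.max 0 (s j - previous_max j))%:E =
    lebesgue_measure `]previous_max j, s j].
  by rewrite lebesgue_measure_itv/= lenE.
apply: le_measure; rewrite ?inE//.
move=> t; rewrite /= in_itv/= => /andP[mt tj]; split => //.
  by rewrite ltW// (le_lt_trans ge0).
move=> i ij; apply: le_lt_trans mt.
exact: (le_bigmax_cond _ (P := fun i : 'I_n => (i < j)%N)).
Qed.

End staircase.

(** * Void probabilities of the Poisson process over a staircase *)

Section void_probability.
Context (d : measure_display) (T : measurableType d) (R : realType)
  (P : probability T R) (X : nat -> T -> R * \bar R).
Hypothesis X_poisson : poisson_point_process P (@extremal_space R)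
  (@extremal_intensity R) X.

Lemma count_points_eq0 (A : set (R * \bar R)) w :
  count_points R X A w = 0%:R%:E <-> forall k, ~ A (X k w).
Proof.
split => [c0 k Ak|nA]; last first.
  by apply: eseries0 => k _ _; rewrite diracE memNset//; exact: nA.
have := @nneseries_lim_ge R (fun k => \d_(X k w) A) xpredT 0 k.+1
  (fun i _ _ => measure_ge0 _ _).
rewrite -/(count_points R X A w) c0 big_nat_recr//= => h.
have : (1 <= 0 :> \bar R)%E.
  apply: le_trans h; rewrite [in leRHS]diracE mem_set//.
  by rewrite leeDr// sume_ge0// => i _; exact: measure_ge0.
by rewrite lee_fin ler10.
Qed.

Definition no_exceedance (n : nat) (u s : 'I_n -> R) : set T :=
  [set w | forall k i, (X k w).1 <= s i -> ((X k w).2 <= (u i)%:E)%E].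

Lemma measurable_no_exceedance n (u s : 'I_n -> R) : measurable (no_exceedance u s).
Proof.
have [mX _ _ _ _] := X_poisson.
rewrite (_ : no_exceedance u s = \bigcap_k \bigcap_(i in [set: 'I_n])
    (X k @^-1` ([set p | s i < p.1] `|` [set p | p.2 <= (u i)%:E]%E))).
  apply: bigcap_measurableType => k _; apply: fin_bigcap_measurable => // i _.
  rewrite -[X in measurable X]setTI; apply: mX => //; apply: measurableU.
    rewrite (_ : [set p | _] = (@fst R (\bar R)) @^-1` `]s i, +oo[).
      by rewrite -[X in measurable X]setTI; apply: measurable_fst.
    by apply/seteqP; split => p /=; rewrite in_itv/= andbT.
  rewrite (_ : [set p | _] = (@snd R (\bar R)) @^-1` `]-oo, (u i)%:E]).
    rewrite -[X in measurable X]setTI; apply: measurable_snd => //.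
    exact: emeasurable_itv.
  by apply/seteqP; split => p /=; rewrite in_itv/=.
apply/seteqP; split => w h.
  move=> k _ i _ /=; have := h k i.
  by case: (leP (X k w).1 (s i)) => ? hi; [right; apply: hi|left].
by move=> k i ks; have [/=|] := h k Logic.I i Logic.I => //; rewrite ltNge ks.
Qed.

Lemma no_exceedance_probability n (u s : 'I_n -> R) :
  (forall i, 0 < u i) -> (forall i j : 'I_n, (i < j)%N -> u i < u j) ->
  P (no_exceedance u s) = (expR (- staircase_mass u s))%:E.
Proof.
move=> u0 uincr; have [mX EX void _ indep] := X_poisson.
pose A (j : 'I_n) : set (R * \bar R) :=
  [set p | first_level s j p.1 /\ ((u j)%:E < p.2)%E].
have mA j : measurable (A j).
  rewrite (_ : A j = (@fst R (\bar R)) @^-1` first_level s j `&`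
      (@snd R (\bar R)) @^-1` `](u j)%:E, +oo%E]).
    apply: measurableI; rewrite -[X in measurable X]setTI.
      by apply: measurable_fst => //; have [] := first_level_measure s j.
    by apply: measurable_snd => //; exact: emeasurable_itv.
  by apply/seteqP; split => p [h1 /=]; rewrite in_itv/= leey andbT.
have AE j : A j `<=` extremal_space (R := R).
  move=> p [[p0 _ _] up]; split => //; apply: lt_trans up.
  by rewrite lte_fin.
have muA j : extremal_intensity (A j) =
    (Num.max 0 (s j - previous_max s j) / u j)%:E.
  have [mD muD] := first_level_measure s j.
  rewrite extremal_intensity_rectangle//; first by rewrite muD -EFinM.
  by move=> t [t0 _ _]; rewrite /= in_itv/= t0.
have disjA : trivIset setT A.
  move=> i j _ _ [p [[pi _] [pj _]]].
  by apply: (@trivIset_first_level _ _ s i j) => //; exists p.1.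
(* A point violating the constraint of level [i] lies in the rectangle of its own first level
   [j <= i], because [u] is increasing. Emptiness of the staircase thus becomes emptiness of
   disjoint rectangles, whose counts are independent. *)
have -> : no_exceedance u s =
    \bigcap_(i in [set` enum 'I_n]) (count_points R X (A i) @^-1` [set 0%:R%:E]).
  apply/seteqP; split => w h.
    move=> j _; apply/count_points_eq0 => k [[_ ks _]].
    by rewrite ltNge (h k j).
  move=> k i ks; have [j ji jt] := first_level_exists (EX k w).1 ks.
  have /count_points_eq0/(_ k) nA := h j (mem_enum _ _).
  rewrite leNgt; apply/negP => uk; apply: nA; split => //.
  apply: le_lt_trans uk; rewrite lee_fin.
  by move: ji; rewrite leq_eqVlt => /orP[/eqP/val_inj ->//|/uincr/ltW].
rewrite (indep _ _ mA AE disjA) ?enum_uniq//.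
have PA j : P (count_points R X (A j) @^-1` [set 0%:R%:E]) =
    (expR (- (Num.max 0 (s j - previous_max s j) / u j)))%:E.
  have := void _ (mA j) (AE j) _ 0%N; rewrite muA/= => -> //; last by rewrite ltry.
  by rewrite expr0 mulr1 fact0 divr1.
under eq_bigr do rewrite PA.
rewrite prodEFin; congr EFin.
rewrite /staircase_mass -sumrN expR_sum big_enum/=.
by apply: eq_bigr.
Qed.
End void_probability.

(** * Joint survival function of the inverse extremal process *)

Section extremal_inverse_law.
Context (d : measure_display) (T : measurableType d) (R : realType)
  (P : probability T R) (X : nat -> T -> R * \bar R).
Hypothesis X_poisson : poisson_point_process P (@extremal_space R)
  (@extremal_intensity R) X.

Lemma extremal_process_leP (y s : R) w : 0 <= y ->
  (extremal_process X s w <= y%:E)%E <->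
  forall k, (X k w).1 <= s -> ((X k w).2 <= y%:E)%E.
Proof.
move=> y0; split => [h k ks|h].
  by apply: le_trans h; apply: ereal_sup_ubound; right; exists k.
by apply: ge_ereal_sup => _ [->|[k ks <-]]; [rewrite lee_fin|exact: h].
Qed.

Lemma extremal_process_homo (s s' : R) w : s <= s' ->
  (extremal_process X s w <= extremal_process X s' w)%E.
Proof.
move=> ss'; apply: le_ereal_sup => y [->|[k ks <-]]; [by left|right].
by exists k => //=; exact: le_trans ss'.
Qed.

(** Absence of exceedances up to [s'] only gives that the infimum is at least [s'], so a strict
    inequality needs room between [s] and [s']. The converse [extremal_inverse_gt] needs none; the
    gap is closed later by continuity of the staircase mass. *)
Lemma lt_extremal_inverse (y s s' : R) w : 0 <= y -> s < s' ->
  (forall k, (X k w).1 <= s' -> ((X k w).2 <= y%:E)%E) ->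
  (s%:E < extremal_inverse X y w)%E.
Proof.
move=> y0 ss' /extremal_process_leP h; apply: (@lt_le_trans _ _ s'%:E).
  by rewrite lte_fin.
apply: le_ereal_inf_tmp => _ [r [r0 hr] <-]; rewrite lee_fin leNgt; apply/negP => rs.
have := le_trans (extremal_process_homo w (ltW rs)) (h y0).
by rewrite leNgt hr.
Qed.

Lemma extremal_inverse_gt (y s : R) w : 0 <= y -> 0 <= s ->
  (s%:E < extremal_inverse X y w)%E ->
  forall k, (X k w).1 <= s -> ((X k w).2 <= y%:E)%E.
Proof.
move=> y0 s0 h; apply/extremal_process_leP => //; rewrite leNgt; apply/negP => ys.
have : (extremal_inverse X y w <= s%:E)%E by apply: ereal_inf_lbound; exists s.
by rewrite leNgt h.
Qed.

(** Since the extremal process is nondecreasing in time, its inverse is below [r] iff a rational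
    time below [r] already has a point higher than [y]. This is a countable union over times and
    points. *)
Lemma measurable_extremal_inverse (y : R) : 0 <= y ->
  measurable_fun setT (extremal_inverse X y).
Proof.
move=> y0; have [mX _ _ _ _] := X_poisson.
apply: (measurability _ (ErealGenInftyO.measurableE R)).
move=> _ [_ [r ->] <-]; rewrite setTI.
rewrite (_ : extremal_inverse X y @^-1` _ = \bigcup_(q : rat) \bigcup_k (X k @^-1`
    ([set p : R * \bar R | (0 <= (ratr q : R) < r) && (p.1 <= ratr q)] `&`
     [set p : R * \bar R | y%:E < p.2]%E))); last first.
  apply/seteqP; split => w.
    rewrite /= in_itv/= => /ereal_inf_lt [_ [s [s0 ys] <-]].
    rewrite lte_fin => sr; have [q] := rat_in_itvoo sr.
    rewrite in_itv/= => /andP[sq qr]; exists q => //.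
    apply: contrapT => nk; move: ys; rewrite ltNge => /negP; apply.
    apply/extremal_process_leP => // k ks; rewrite leNgt; apply/negP => yk.
    apply: nk; exists k => //; split => //=.
    by rewrite qr (le_trans s0 (ltW sq)) (le_trans ks (ltW sq)).
  move=> [q _ [k _ [/= /andP[/andP[q0 qr] ks] yk]]]; rewrite in_itv/=.
  apply: (@le_lt_trans _ _ (ratr q)%:E); last by rewrite lte_fin.
  apply: ereal_inf_lbound; exists (ratr q) => //; split => //.
  rewrite ltNge; apply/negP => /extremal_process_leP h.
  by have := h y0 k ks; rewrite leNgt yk.
apply: countable_bigcupT_measurable => [|q]; first exact: countableP.
apply: bigcupT_measurable => k; rewrite -[X in measurable X]setTI.
apply: mX => //; apply: measurableI.
  case: (boolP (0 <= ratr q < r)) => _ /=; last first.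
    by rewrite [X in measurable X](_ : _ = set0)//; apply/seteqP; split.
  rewrite (_ : [set p | _] = (@fst R (\bar R)) @^-1` `]-oo, ratr q]).
    by rewrite -[X in measurable X]setTI; apply: measurable_fst.
  by apply/seteqP; split => p /=; rewrite in_itv/=.
rewrite (_ : [set p | _] = (@snd R (\bar R)) @^-1` `]y%:E, +oo%E]).
  rewrite -[X in measurable X]setTI; apply: measurable_snd => //.
  exact: emeasurable_itv.
by apply/seteqP; split => p /=; rewrite in_itv/= leey andbT.
Qed.

(** [fine] sends [+oo] to 0, so infinite values would drop out of the survival events; this makes
    them a null event. *)
Lemma extremal_inverse_infinite (y : R) : 0 < y ->
  P [set w | extremal_inverse X y w = +oo%E] = 0%E.
Proof.
move=> y0; apply/eqP; rewrite eq_le measure_ge0 andbT.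
apply/lee_addgt0Pr => e e0; rewrite add0e.
(* Having no point above [y] up to time [K] has probability exp(- K / y), which is at most [e] for
   this [K]. *)
pose K := Num.max 0 (- ln e * y).
pose s := fun _ : 'I_1 => K; pose u := fun _ : 'I_1 => y.
apply: (@le_trans _ _ (P (no_exceedance X u s))).
  apply: le_measure; rewrite ?inE.
  - rewrite (_ : [set w | _] = extremal_inverse X y @^-1` [set +oo%E])//.
    rewrite -[X in measurable X]setTI.
    by apply: measurable_extremal_inverse => //; exact: ltW.
  - exact: (measurable_no_exceedance X_poisson).
  move=> w /= wy k i; apply: extremal_inverse_gt; first exact: ltW.
    by rewrite le_max lexx.
  by rewrite wy ltry.
rewrite (no_exceedance_probability X_poisson)//; last by move=> i j; rewrite !ord1.
rewrite lee_fin /staircase_mass big_ord1 /previous_max big_pred0; last first.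
  by move=> i; rewrite !ord1.
rewrite subr0 -[leRHS]lnK ?posrE// ler_expR lerNl /s max_r; last by rewrite le_max lexx.
by rewrite ler_pdivlMr// le_max lexx orbT.
Qed.

(** Raising all thresholds by [e] does not lower the previous maxima, so each numerator grows by at
    most [e]. *)
Lemma staircase_mass_shift (n : nat) (u s : 'I_n -> R) (e : R) :
  (forall i, 0 < u i) -> 0 <= e ->
  staircase_mass u (fun i => s i + e) <= staircase_mass u s + e * \sum_i (u i)^-1.
Proof.
move=> u0 e0; rewrite mulr_sumr -big_split/=; apply: ler_sum => j _.
rewrite -mulrDl ler_pM2r ?invr_gt0//.
have h : previous_max s j <= previous_max (fun i => s i + e) j.
  by apply: le_bigmax2 => i _; rewrite lerDl.
rewrite ge_max addr_ge0 ?le_max ?lexx//=.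
rewrite -lerBlDr le_max; apply/orP; right; move: h; lra.
Qed.

(** The survival event is contained in the void event at [s] and, up to a null event, contains the
    void event at [s + e] for every [e > 0]. The two probabilities meet as [e] tends to 0. *)
Lemma extremal_inverse_survival (n : nat) (u s : 'I_n -> R) :
  (forall i, 0 < u i) -> (forall i j : 'I_n, (i < j)%N -> u i < u j) ->
  (forall i, 0 <= s i) ->
  P [set w | forall i, s i < fine (extremal_inverse X (u i) w)] =
  (expR (- staircase_mass u s))%:E.
Proof.
move=> u0 uincr s0; set A := [set w | _].
have mA : measurable A.
  rewrite (_ : A = \bigcap_(i in [set: 'I_n])
      ((fun w => fine (extremal_inverse X (u i) w)) @^-1` `]s i, +oo[)).
    apply: fin_bigcap_measurable => // i _; rewrite -[X in measurable X]setTI.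
    apply: measurableT_comp => //.
    by apply: measurable_extremal_inverse; exact: ltW.
  apply/seteqP; split => w h i; first by rewrite /= in_itv/= h.
  by have := h i Logic.I; rewrite /= in_itv/= andbT.
apply/eqP; rewrite eq_le; apply/andP; split.
  rewrite -(no_exceedance_probability X_poisson)//; apply: le_measure; rewrite ?inE//.
    exact: (measurable_no_exceedance X_poisson).
  move=> w Aw k i; apply: extremal_inverse_gt => //; first exact: ltW.
  have := Aw i; case: (extremal_inverse X (u i) w) => [r| |]//=; first by rewrite ltry.
  by rewrite ltNge s0.
have key e : 0 < e ->
    ((expR (- (staircase_mass u s + e * \sum_i (u i)^-1)))%:E <= P A)%E.
  move=> e0.
  pose B := \big[setU/set0]_(i < n) [set w | extremal_inverse X (u i) w = +oo%E].
  have mI i : measurable [set w | extremal_inverse X (u i) w = +oo%E].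
    rewrite (_ : [set w | _] = extremal_inverse X (u i) @^-1` [set +oo%E])//.
    rewrite -[X in measurable X]setTI.
    by apply: measurable_extremal_inverse => //; exact: ltW.
  have [mB PB] : measurable B /\ P B = 0%E.
    rewrite /B; elim/big_ind: _ => [|S S' [mS PS] [mS' PS']|i _].
    - by split => //; exact: measure0.
    - split; first exact: measurableU.
      apply/eqP; rewrite eq_le measure_ge0 andbT.
      apply: le_trans (measureU2 _ mS mS') _.
      by rewrite [X in (X + _)%E]PS [X in (_ + X)%E]PS' adde0.
    - by split; [exact: mI|exact: extremal_inverse_infinite].
  apply: (@le_trans _ _ (P (no_exceedance X u (fun i => s i + e)))).
    rewrite (no_exceedance_probability X_poisson)// lee_fin ler_expR lerN2.
    exact: staircase_mass_shift (ltW e0).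
  apply: (@le_trans _ _ (P (A `|` B))).
    apply: le_measure; rewrite ?inE//.
    - exact: (measurable_no_exceedance X_poisson).
    - exact: measurableU.
    move=> w h; have [Bw|nB] := pselect (B w); [by right|left => i].
    have : ((s i)%:E < extremal_inverse X (u i) w)%E.
      apply: (@lt_extremal_inverse _ _ (s i + e)); first exact: ltW.
        by rewrite ltrDl.
      by move=> k; exact: h.
    case E : (extremal_inverse X (u i) w) => [r| |]//=.
    move=> _; exfalso; apply: nB; by rewrite /B (bigD1 i)//=; left.
  apply: le_trans (measureU2 _ mA mB) _.
  by rewrite [X in (_ + X)%E]PB adde0.
rewrite -(fineK (fin_num_measure P _ mA)) lee_fin.
set m := staircase_mass u s; set c := \sum_i (u i)^-1.
have c0 : 0 <= c by apply: sumr_ge0 => i _; rewrite invr_ge0 ltW.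
have cm0 : 0 <= c * expR (- m) by rewrite mulr_ge0 ?expR_ge0.
apply/ler_addgt0Pr => e e0.
(* By exp(- e' c) >= 1 - e' c, shifting by e' costs at most e' c exp(- m), which is at most [e] for
   this choice; [+ 1] keeps the denominator positive. *)
have e'0 : 0 < e / (c * expR (- m) + 1) by rewrite divr_gt0// ltr_wpDl.
have h := key _ e'0; rewrite -[leRHS](fineK (fin_num_measure P _ mA)) lee_fin in h.
rewrite -lerBlDr; apply: le_trans h.
rewrite -/m -/c opprD expRD; apply: le_trans (ler_wpM2l (expR_ge0 _) (expR_ge1Dx _)).
rewrite mulrDr mulr1 lerD2l mulrN lerN2 mulrCA mulrAC ler_pdivrMr ?ltr_wpDl//.
by rewrite ler_pM2l// [_ * c]mulrC lerDl.
Qed.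

End extremal_inverse_law.

(** * Passage of a high level in a single jump *)

Lemma divr_cvgy (R : realType) (a : R) : 0 < a -> (x / a) @[x --> +oo] --> +oo.
Proof.
move=> a0; apply/cvgryPge => M; by near=> x; rewrite ler_pdivlMr.
Unshelve. all: by end_near.
Qed.

Section truncated_mean.
Context (d : measure_display) (T : measurableType d) (R : realType)
  (P : probability T R) (xi : {RV P >-> R}).

Definition tail (x : R) : R := fine (P [set w | x < xi w]).

(** Cutting at 0 as well keeps the values in [0, x] everywhere when [0 <= x], although a step is
    positive only almost surely. *)
Definition truncation (x y : R) : R := y * \1_(`]0, x] : set R) y.

Definition truncated_mean (x : R) : R := \int[P]_w truncation x (xi w).

Lemma truncation_ge0 x y : 0 <= truncation x y.
Proof.
rewrite /truncation indicE; have [|_] := boolP (y \in _); last by rewrite mulr0.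
by rewrite inE/= in_itv/= mulr1 => /andP[/ltW].
Qed.

Lemma truncation_le x y : 0 <= x -> truncation x y <= x.
Proof.
rewrite /truncation indicE => x0; have [|_] := boolP (y \in _); last by rewrite mulr0.
by rewrite inE/= in_itv/= mulr1 => /andP[].
Qed.

Lemma measurable_truncation x : measurable_fun setT (truncation x).
Proof.
by apply: measurable_funM => //; exact: measurable_indic.
Qed.

Lemma integrable_truncation x (X : T -> R) : 0 <= x -> measurable_fun setT X ->
  P.-integrable setT (EFin \o (fun w => truncation x (X w))).
Proof.
move=> x0 mX; apply: (@bounded_integrable _ _ _ _ _ x).
  exact: (measurableT_comp (measurable_truncation x)).
by move=> w; rewrite ger0_norm ?truncation_ge0// truncation_le.
Qed.

Lemma measurable_tail_event x : measurable [set w | x < xi w].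
Proof.
rewrite (_ : [set w | _] = xi @^-1` `]x, +oo[).
  by rewrite -[X in measurable X]setTI; exact: measurable_funPT.
by apply/seteqP; split => w /=; rewrite in_itv/= andbT.
Qed.

Lemma truncated_mean_le x : 0 <= x -> truncated_mean x <= x.
Proof.
move=> x0; have xE : \int[P]_w (cst x w) = x.
  transitivity (x * fine (P setT)); first exact: Rintegral_cst.
  by rewrite probability_setT mulr1.
rewrite -[leRHS]xE.
apply: le_Rintegral => //; first exact: integrable_truncation.
- exact: finite_measure_integrable_cst.
- by move=> w _; exact: truncation_le.
Qed.

Lemma truncated_mean_ge0 x : 0 <= truncated_mean x.
Proof. by apply: Rintegral_ge0 => w _; exact: truncation_ge0. Qed.

(* Multiplied by [L x / x], this recursion halves the truncated mean up to a
   vanishing error, so that Karamata's theorem is not needed. *)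
Lemma truncated_mean_halve x : 0 <= x ->
  truncated_mean x <= x * (tail (x / 2) - tail x) + truncated_mean (x / 2).
Proof.
move=> x0; have x2 : 0 <= x / 2 by rewrite divr_ge0.
have xx2 : x / 2 <= x by rewrite ler_pdivrMr// ler_peMr// ler1n.
set A := [set w | x / 2 < xi w] `\` [set w | x < xi w].
have mA : measurable A by apply: measurableD; exact: measurable_tail_event.
have PA : fine (P A) = tail (x / 2) - tail x.
  rewrite measureD//=;
    [|exact: measurable_tail_event|exact: measurable_tail_event|]; last first.
    rewrite (le_lt_trans (probability_le1 P _)) ?ltry//.
    exact: measurable_tail_event.
  rewrite fineB ?fin_num_measure//.
  - congr (_ - fine (P _)); apply/setIidPr => w /=; exact: le_lt_trans.
  - exact: measurable_tail_event.
  - by apply: measurableI; exact: measurable_tail_event.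
have iA : P.-integrable setT (EFin \o (fun w => x * \1_A w)).
  apply: (@integrableZl _ _ _ P setT measurableT x (EFin \o \1_A)).
  exact: integrable_indic.
have it y : 0 <= y -> P.-integrable setT (EFin \o (fun w => truncation y (xi w))).
  by move=> y0; exact: integrable_truncation.
rewrite -PA; have -> : x * fine (P A) = \int[P]_w (x * \1_A w).
  rewrite RintegralZl//; last exact: integrable_indic.
  by rewrite /Rintegral integral_indic// setIT.
rewrite /truncated_mean -RintegralD//; last exact: it.
apply: le_Rintegral => //; first exact: it.
  exact: (integrableD measurableT iA (it _ x2)).
move=> w _; have t2 := truncation_ge0 (x / 2) (xi w).
rewrite [leLHS]/truncation !indicE.
have [|_] := boolP (xi w \in `]0, x]%classic); last first.
  by rewrite mulr0 addr_ge0// mulr_ge0.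
rewrite inE/= in_itv/= mulr1 => /andP[w0 wx].
have [wx2|wx2] := leP (xi w) (x / 2).
  rewrite /truncation [\1_`]_, _] _]indicE (_ : xi w \in `]0, x / 2]%classic).
    by rewrite mulr1 lerDr mulr_ge0.
  by rewrite inE/= in_itv/= w0.
rewrite mem_set ?mulr1.
  by rewrite ler_wpDr.
by split => //=; apply/negP; rewrite -leNgt.
Qed.

Variable L : R -> R.
Hypotheses (L_ge0 : forall x, 0 <= x -> 0 <= L x)
  (L_nd : forall x y, 0 <= x -> x <= y -> L x <= L y)
  (L_slow : slowly_varying L)
  (L_tail : asymp_equiv tail (fun x => 1 / L x)).

Lemma tail_mul_cvg : tail x * L x @[x --> +oo] --> (1 : R).
Proof.
apply: cvg_trans L_tail; apply: near_eq_cvg; near=> x.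
by rewrite div1r invrK.
Unshelve. all: by end_near.
Qed.

Lemma slowly_varying_half : L x / L (x / 2) @[x --> +oo] --> (1 : R).
Proof.
have [_ _ _ /(_ 2^-1)] := L_slow; rewrite invr_gt0 ltr0n powRr0 => /(_ isT) h.
rewrite -[X in _ --> X]invr1.
rewrite (_ : (fun x => L x / L (x / 2)) = fun x => (L (2^-1 * x) / L x)^-1).
  exact: cvgV.
by apply/funext => x; rewrite invf_div [x / 2]mulrC.
Qed.

(** A sum of order [L x] truncated steps thus has mean o(x), which is why the walk is still low when
    the first large jump comes. *)
Lemma truncated_mean_cvg0 : truncated_mean x * L x / x @[x --> +oo] --> (0 : R).
Proof.
pose a x := truncated_mean x * L x / x.
have a_ge0 x : 0 <= x -> 0 <= a x.
  move=> x0; rewrite divr_ge0// mulr_ge0 ?truncated_mean_ge0//; exact: L_ge0.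
have tail_half : (tail (x / 2) - tail x) * L x @[x --> +oo] --> (0 : R).
  have h2 : (tail (x / 2) * L (x / 2)) * (L x / L (x / 2)) @[x --> +oo] --> (1 * 1 : R).
    apply: cvgM slowly_varying_half.
    exact: (cvg_comp _ _ (divr_cvgy (ltr0n R 2)) tail_mul_cvg).
  have h3 : (tail (x / 2) * L (x / 2)) * (L x / L (x / 2)) - tail x * L x
      @[x --> +oo] --> (0 : R).
    have -> : 0 = 1 * 1 - 1 :> R by rewrite mulr1 subrr.
    exact: cvgB h2 tail_mul_cvg.
  apply: (cvg_trans _ h3); apply: near_eq_cvg.
  have [_ _ Lpos _] := L_slow.
  have Lpos2 : \forall x \near +oo, 0 < L (x / 2).
    exact: (divr_cvgy (ltr0n R 2) Lpos).
  near=> x; have Lx2 : 0 < L (x / 2) by near: x; exact: Lpos2.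
  rewrite mulrBl; congr (_ - _).
  by field; rewrite gt_eqF.
have [_ _ Lpos _] := L_slow.
apply/cvgrPdist_le => e e0; have e8 : 0 < e / 8 by rewrite divr_gt0.
(* Eventually [L x / L (x / 2) <= 3 / 2], and halving the argument contributes 1/2, whence the
   contraction factor 3/4. The additive term [e / 8] gives the recursion the fixed point [e / 2]. *)
have [X X0 hX] : exists2 X, 0 < X &
    forall x, X <= x -> a x <= e / 8 + 3 / 4 * a (x / 2).
  have /cvgrPdist_le/(_ _ e8) n1 := tail_half.
  have /cvgrPdist_le/(_ _ (divr_gt0 ltr01 (ltr0n R 2))) n2 := slowly_varying_half.
  have n3 : \forall x \near +oo, 0 < L (x / 2).
    exact: (divr_cvgy (ltr0n R 2) Lpos).
  have [M [_ hM]] : \forall x \near +oo, 0 < x /\ a x <= e / 8 + 3 / 4 * a (x / 2).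
    near=> x.
    have x0 : 0 < x by near: x; exact: nbhs_pinfty_gt (num_real _).
    split => //; have Lx2 : 0 < L (x / 2) by near: x; exact: n3.
    have : `|0 - (tail (x / 2) - tail x) * L x| <= e / 8 by near: x; exact: n1.
    have : `|1 - L x / L (x / 2)| <= 1 / 2 by near: x; exact: n2.
    rewrite !ler_norml => /andP[r1 r2] /andP[t1 t2].
    apply: (@le_trans _ _ ((tail (x / 2) - tail x) * L x +
        (L x / L (x / 2)) / 2 * a (x / 2))); last first.
      apply: lerD; first by move: t1; lra.
      by apply: ler_wpM2r; [rewrite a_ge0// divr_ge0 ?ltW|lra].
    rewrite (_ : _ + _ =
        (x * (tail (x / 2) - tail x) + truncated_mean (x / 2)) * L x / x).
      rewrite /a ler_pM2r ?invr_gt0//; apply: ler_wpM2r; first by rewrite L_ge0 ?ltW.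
      exact: truncated_mean_halve (ltW x0).
    by rewrite /a; field; rewrite !gt_eqF.
  exists (Num.max 1 (M + 1)); first by rewrite lt_max ltr01.
  move=> x; rewrite ge_max => /andP[x1 Mx].
  by have [] := hM x; first by lra.
(* [L X] bounds [a] on [0, X], because the truncated mean is at most [x] there, and [C >= e / 2]
   makes the bound stable under the recursion. *)
pose C := L X + e / 2.
have LX : 0 <= L X by exact: L_ge0 (ltW X0).
have C0 : 0 < C by move: e0 LX; rewrite /C; lra.
have LC : L X <= C by move: e0; rewrite /C; lra.
have a_small x : 0 <= x -> x <= X -> a x <= L X.
  move=> x0 xX; apply: (@le_trans _ _ (L x)); last exact: L_nd.
  have [->|xN0] := eqVneq x 0; first by rewrite /a invr0 mulr0 L_ge0.
  have {}x0 : 0 < x by rewrite lt0r xN0.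
  rewrite /a ler_pdivrMr// [leRHS]mulrC; apply: ler_wpM2r.
    by rewrite L_ge0 ?ltW.
  by rewrite truncated_mean_le// ltW.
have a_bnd k : forall x, 0 <= x -> x <= 2 ^+ k * X -> a x <= C.
  elim: k => [|k ih] x x0 xX.
    by apply: le_trans LC; apply: a_small => //; rewrite -[X]mul1r.
  have [xX'|Xx] := leP x X.
    by apply: le_trans LC; exact: a_small.
  have := hX x (ltW Xx); have := ih (x / 2).
  rewrite divr_ge0// ler_pdivrMr// mulrAC -exprSr => /(_ isT xX).
  by move: LX; rewrite /C; lra.
(* Above [2 ^+ k * X] the recursion can be applied [k] times, each time contracting the distance to
   the fixed point. *)
have a_dec k : forall x, 2 ^+ k * X <= x -> a x <= e / 2 + (3 / 4) ^+ k * C.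
  elim: k => [|k ih] x Xx.
    rewrite expr0 mul1r in Xx; rewrite expr0 mul1r.
    have x0 : 0 <= x by rewrite (le_trans _ Xx)// ltW.
    apply: (@le_trans _ _ C); last by rewrite lerDr divr_ge0// ltW.
    apply: (a_bnd (Num.truncn (x / X)).+1) => //.
    rewrite -ler_pdivrMr//; apply: le_trans (ltW (truncnS_gt _)) _.
    by rewrite -natrX ler_nat ltnW// ltn_expl.
  have XX : X <= x.
    by apply: le_trans Xx; apply: ler_peMl; [exact: ltW|rewrite exprn_ege1// ler1n].
  have := hX x XX; have := ih (x / 2).
  rewrite ler_pdivlMr// mulrAC -exprSr => /(_ Xx).
  by rewrite [(3 / 4) ^+ k.+1]exprS; lra.
have [k hk] : exists k, (3 / 4) ^+ k * C <= e / 2.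
  have q1 : `|3 / 4 : R| < 1 by rewrite ger0_norm; lra.
  have eC : 0 < e / 2 / C by rewrite !divr_gt0.
  have /cvgrPdist_le/(_ _ eC)[k _ hk] := cvg_expr q1.
  exists k; rewrite -ler_pdivlMr//; have := hk k (leqnn k).
  by rewrite /= sub0r normrN; apply: le_trans; exact: ler_norm.
near=> x.
have x0 : 0 <= x by near: x; exact: nbhs_pinfty_ge (num_real _).
have xk : 2 ^+ k * X <= x by near: x; exact: nbhs_pinfty_ge (num_real _).
rewrite sub0r normrN -/(a x) ger0_norm ?a_ge0//.
by rewrite [e]splitr (le_trans (a_dec k x xk))// lerD2l.
Unshelve. all: by end_near.
Qed.

End truncated_mean.

(** * Pathwise estimates around the first large jump *)

Section walk_with_a_large_jump.
Context (R : realType) (Omega : Type) (xi : nat -> Omega -> R) (w : Omega).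
Hypothesis xi_gt0 : forall k, 0 < xi k w.

Lemma random_walkS k : random_walk xi k.+1 w = random_walk xi k w + xi k w.
Proof. by rewrite /random_walk big_ord_recr. Qed.

Lemma random_walk_nd k l : (k <= l)%N -> random_walk xi k w <= random_walk xi l w.
Proof.
move=> /subnKC <-; elim: (l - k)%N => [|j ih]; first by rewrite addn0.
by rewrite addnS random_walkS (le_trans ih)// lerDl ltW.
Qed.

Lemma random_walk_ge0 k : 0 <= random_walk xi k w.
Proof. by rewrite /random_walk sumr_ge0// => i _; exact: ltW. Qed.

(** The step [xi m] leads from position [m] to position [m.+1], already beyond [x], and the walk
    never returns. The positions 0 to [m] remain, which gives [m.+1] terms and a finite value. *)
Lemma shot_noise_large_jump (h : R -> R) (x : R) (m : nat) :
  (forall y, 0 <= y -> 0 <= h y) ->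
  random_walk xi m w <= x -> x < xi m w ->
  shot_noise xi h x w = (\sum_(k < m.+1) h (x - random_walk xi k w))%:E.
Proof.
move=> h0 Smx xm.
rewrite /shot_noise (nneseries_split 0%N m.+1); last first.
  by move=> k _; rewrite lee_fin; case: ifPn => // ?; rewrite h0// subr_ge0.
rewrite add0n eseries0 ?adde0; last first.
  move=> k mk _; rewrite ifF//; apply/negbTE; rewrite -ltNge.
  apply: lt_le_trans (random_walk_nd mk); rewrite random_walkS.
  by rewrite (lt_le_trans xm)// lerDr random_walk_ge0.
rewrite sumEFin big_mkord; congr EFin; apply: eq_bigr => k _.
by rewrite ifT// (le_trans _ Smx)// random_walk_nd// -ltnS.
Qed.

(** The random index [m] is replaced by a fixed horizon [N]: the right-hand side is a sum with a
    deterministic number of terms, to which Markov's inequality applies. *)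
Lemma random_walk_truncation (x : R) (m N : nat) : (m <= N)%N ->
  (forall k, (k < m)%N -> xi k w <= x) ->
  random_walk xi m w <= \sum_(k < N) truncation x (xi k w).
Proof.
move=> mN small; apply: (@le_trans _ _ (\sum_(k < m) truncation x (xi k w))).
  apply: ler_sum => k _; rewrite /truncation indicE mem_set ?mulr1//=.
  by rewrite in_itv/= xi_gt0 small.
rewrite -(big_mkord xpredT (fun k => truncation x (xi k w))).
rewrite -(big_mkord xpredT (fun k => truncation x (xi k w))).
rewrite [leRHS](big_cat_nat (n := m))//= lerDl.
by apply: sumr_ge0 => k _; exact: truncation_ge0.
Qed.

End walk_with_a_large_jump.

Section iid_steps.
Context (d : measure_display) (T : measurableType d) (R : realType)
  (P : probability T R) (xi : {RV P >-> R}) (xis : nat -> {RV P >-> R}).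
Hypothesis xis_copies : forall i (B : set R), measurable B ->
  distribution P (xis i) B = distribution P xi B.
Hypothesis xis_indep : independent_family P (fun i => xis i : T -> R).

Lemma iid_probability (K : nat) (B : nat -> set R) : (forall k, measurable (B k)) ->
  P [set w | forall k, (k < K)%N -> B k (xis k w)] =
  (\prod_(k < K) fine (P (xi @^-1` B k)))%:E.
Proof.
move=> mB.
have -> : [set w | forall k, (k < K)%N -> B k (xis k w)] =
    \bigcap_(k in [set` iota 0 K]) (xis k @^-1` B k).
  apply/seteqP; split => w h k; first by rewrite /= mem_iota; exact: h.
  by move=> kK; apply: (h k); rewrite /= mem_iota.
rewrite xis_indep ?iota_uniq// -prodEFin.
rewrite -[in LHS](subn0 K) -/(index_iota 0 K) big_mkord; apply: eq_bigr => k _.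
rewrite fineK; first exact: xis_copies.
by apply: fin_num_measure; rewrite -[X in measurable X]setTI; exact: measurable_funPT.
Qed.

Lemma truncated_mean_copy k x : 0 <= x ->
  \int[P]_w truncation x (xis k w) = truncated_mean xi x.
Proof.
move=> x0; rewrite /truncated_mean /Rintegral; congr fine.
have E (X : {RV P >-> R}) : (\int[P]_w (truncation x (X w))%:E =
    \int[distribution P X]_y (truncation x y)%:E)%E.
  rewrite ge0_integral_distribution//.
    by apply/measurable_EFinP; exact: measurable_truncation.
  by move=> y; rewrite lee_fin truncation_ge0.
rewrite !E; apply: eq_measure_integral => A mA _; exact: xis_copies.
Qed.

Lemma truncated_walk_markov N (x : R) : 0 < x ->
  (P [set w | (x / 2 < \sum_(k < N) truncation x (xis k w))%R] <=
   (2 * N%:R * truncated_mean xi x / x)%:E)%E.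
Proof.
move=> x0; set A := [set w | _].
pose S w := \sum_(k < N) truncation x (xis k w).
have mt k : measurable_fun setT (fun w => truncation x (xis k w)).
  exact: (measurableT_comp (measurable_truncation x)).
have mS : measurable_fun setT S by exact: measurable_sum.
have mA : measurable A.
  rewrite (_ : A = S @^-1` `]x / 2, +oo[).
    by rewrite -[X in measurable X]setTI; exact: mS.
  by apply/seteqP; split => w /=; rewrite in_itv/= andbT.
have it k : P.-integrable setT (EFin \o (fun w => truncation x (xis k w))).
  by apply: integrable_truncation => //; exact: ltW.
have iS : P.-integrable setT (EFin \o S).
  rewrite (_ : _ \o _ =
      fun w => (\sum_(k < N) (truncation x (xis k w))%:E)%E); last first.
    by apply/funext => w /=; rewrite sumEFin.
  by apply: integrable_sum => // k _; exact: it.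
have ES : \int[P]_w S w = N%:R * truncated_mean xi x.
  rewrite /Rintegral /S; under eq_integral do rewrite -sumEFin.
  rewrite integral_sum//; last by move=> k; exact: it.
  rewrite -sum_fine; last by move=> k _; apply: integrable_fin_num => //; exact: it.
  rewrite (eq_bigr (fun=> truncated_mean xi x)); last first.
    by move=> k _; rewrite -(truncated_mean_copy k (ltW x0)).
  by rewrite sumr_const card_ord mulr_natl.
have iA : P.-integrable setT (EFin \o (fun w => x / 2 * \1_A w)).
  apply: (@integrableZl _ _ _ P setT measurableT (x / 2) (EFin \o \1_A)).
  exact: integrable_indic.
have : \int[P]_w (x / 2 * \1_A w) <= \int[P]_w S w.
  apply: le_Rintegral => // w _; rewrite indicE; have [|_] := boolP (w \in A).
    by rewrite inE mulr1 => /ltW.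
  by rewrite mulr0 sumr_ge0// => k _; exact: truncation_ge0.
rewrite RintegralZl//; last exact: integrable_indic.
have -> : \int[P]_w \1_A w = fine (P A) by rewrite /Rintegral integral_indic// setIT.
rewrite ES -(fineK (fin_num_measure P _ mA)) lee_fin => h.
rewrite ler_pdivlMr//; move: h; lra.
Qed.

End iid_steps.

(** * Shot noise at a single high level *)

Section single_level.
Context (d : measure_display) (T : measurableType d) (R : realType)
  (P : probability T R) (xi : {RV P >-> R}) (xis : nat -> {RV P >-> R})
  (L Linv h : R -> R) (alpha : R).
Hypotheses (xi_pos : P [set w | 0 < xi w] = 1%E)
  (xis_copies : forall i (B : set R), measurable B ->
     distribution P (xis i) B = distribution P xi B)
  (xis_indep : independent_family P (fun i => xis i : T -> R))
  (L_ge0 : forall x, 0 <= x -> 0 <= L x)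
  (L_nd : forall x y, 0 <= x -> x <= y -> L x <= L y)
  (L_slow : slowly_varying L)
  (L_infty : L x @[x --> +oo] --> +oo)
  (LK : forall t, 0 <= t -> Linv (L t) = t)
  (h_ge0 : forall x, 0 <= x -> 0 <= h x)
  (h_regular : regularly_varying (h \o Linv) alpha)
  (L_tail : asymp_equiv (tail xi) (fun x => 1 / L x)).

(** Write [h y] as [(h \o Linv) (L y)]. Since [L x / L (x / 2)] tends to 1, it is eventually at most
    [lam^-1]; by monotonicity [L y] then lies in the window [lam * L x, L x] of uniform
    convergence. *)
Lemma near_constant_on_halves (delta : R) : 0 < delta ->
  \forall x \near +oo, 0 < h x /\
    forall y, x / 2 <= y <= x -> `|h y - h x| <= delta * h x.
Proof.
move=> d0; have [lam /andP[lam0 lam1] n1] :=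
  regularly_varying_left_uniform h_regular d0.
have [_ _ n2 _] := h_regular; have [_ _ Lpos _] := L_slow.
have lam'0 : 0 < lam^-1 - 1 by rewrite subr_gt0 invf_gt1.
have /cvgrPdist_le/(_ _ lam'0) n3 := slowly_varying_half L_slow.
have n4 := divr_cvgy (ltr0n R 2) Lpos.
have n1' := L_infty n1; have n2' := L_infty n2.
near=> x.
have x0 : 0 < x by [].
have Lx2 : 0 < L (x / 2) by near: x; exact: n4.
have hx : 0 < h x by rewrite -[x]LK ?ltW//; near: x; exact: n2'.
split => // y /andP[xy yx].
have y0 : 0 <= y by rewrite (le_trans _ xy)// divr_ge0// ltW.
have : `|1 - L x / L (x / 2)| <= lam^-1 - 1 by near: x; exact: n3.
rewrite ler_norml => /andP[r1 _].
have lamL : lam * L x <= L (x / 2).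
  have : L x / L (x / 2) <= lam^-1 by move: r1; lra.
  by rewrite ler_pdivrMr// -ler_pdivrMl ?invr_gt0// invrK.
have u : forall s, lam * L x <= s <= L x ->
    `|(h \o Linv) s / (h \o Linv) (L x) - 1| < delta by near: x; exact: n1'.
have := u (L y); rewrite /= !LK ?(ltW x0)// => -/(_ _)/ltW.
have -> : h y - h x = (h y / h x - 1) * h x by field; rewrite gt_eqF.
rewrite normrM (gtr0_norm hx) ler_pM2r//; apply.
by rewrite (le_trans lamL) ?L_nd// divr_ge0// ltW.
Unshelve. all: by end_near.
Qed.

(** Steps are indexed from 0, so [m.+1] is both tau(x) and the number of terms of the shot noise. *)
Definition first_jump_approximation (delta x : R) (w : T) (m : nat) : Prop :=
  [/\ forall k, (k < m)%N -> xis k w <= x, x < xis m w &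
      (1 - delta) * (m.+1%:R * h x) <= fine (shot_noise (fun k => xis k : T -> R) h x w)
        <= (1 + delta) * (m.+1%:R * h x)].

(** The good event asks that all steps be positive, that one of the first [N] exceed [x], and that
    the [N] truncated steps sum to at most [x / 2]. The first condition is almost sure; each of the
    others fails with probability at most [eta / 2]. *)
Lemma shot_noise_first_jump (delta eta : R) : 0 < delta -> 0 < eta ->
  \forall x \near +oo, exists G : set T, [/\ measurable G, (P (~` G) <= eta%:E)%E &
    forall w, G w -> exists m, first_jump_approximation delta x w m].
Proof.
move=> d0 eta0.
(* With [N] the integer part of [K * L x], [tail x <= 1] and [tail x * L x >= 1 / 2], the exponent
   [tail x * N] is at least [K / 2 - 1]. Hence no large step among the first [N] has probability at
   most exp(1 - K / 2). *)
have [K K0 hK] : exists2 K : R, 0 < K & expR (1 - K / 2) <= eta / 2.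
  exists (Num.max 1 (2 * (1 - ln (eta / 2)))); first by rewrite lt_max ltr01.
  rewrite -[leRHS]lnK ?posrE ?divr_gt0// ler_expR.
  have : 2 * (1 - ln (eta / 2)) <= Num.max 1 (2 * (1 - ln (eta / 2))).
    by rewrite le_max lexx orbT.
  by lra.
have n1 := near_constant_on_halves d0.
have /cvgrPdist_le/(_ (1 / 2)) := tail_mul_cvg L_tail.
rewrite divr_gt0// => /(_ isT) n2.
(* Markov's inequality at [x / 2] gives a factor 2 and the horizon a factor [K], leaving
   [eta / 2]. *)
have eK0 : 0 < eta / 4 / K by rewrite !divr_gt0.
have /cvgrPdist_le/(_ _ eK0) n3 := truncated_mean_cvg0 L_ge0 L_nd L_slow L_tail.
near=> x.
have x0 : 0 < x by [].
have [hx hunif] : 0 < h x /\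
    forall y, x / 2 <= y <= x -> `|h y - h x| <= delta * h x by near: x; exact: n1.
have : `|1 - tail xi x * L x| <= 1 / 2 by near: x; exact: n2.
rewrite ler_norml => /andP[_ pL].
have : `|0 - truncated_mean xi x * L x / x| <= eta / 4 / K by near: x; exact: n3.
rewrite ler_norml => /andP[tmL _].
have Lx : 0 <= L x by rewrite L_ge0// ltW.
pose N := Num.truncn (K * L x).
have /andP[N1 N2] : N%:R <= K * L x < N.+1%:R.
  by apply: truncn_itv; rewrite mulr_ge0// ltW.
pose A1 := [set w | forall k, 0 < xis k w].
pose A2 := [set w | forall k, (k < N)%N -> xis k w <= x].
pose A3 := [set w | x / 2 < \sum_(k < N) truncation x (xis k w)].
have mxi (B : set R) k : measurable B -> measurable (xis k @^-1` B).
  by move=> mB; rewrite -[X in measurable X]setTI; exact: measurable_funPT.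
have A1E : A1 = \bigcap_k (xis k @^-1` `]0, +oo[).
  apply/seteqP; split => w hw k; first by move=> _; rewrite /= in_itv/= hw.
  by have := hw k Logic.I; rewrite /= in_itv/= andbT.
have mA1 : measurable A1.
  by rewrite A1E; apply: bigcapT_measurable => k; exact: mxi.
have PA1 : P (~` A1) = 0%E.
  apply/negligibleP; first exact: measurableC.
  rewrite A1E setC_bigcap; apply: negligible_bigcup => k.
  apply/negligibleP; first by apply: measurableC; exact: mxi.
  transitivity (1 - P (xis k @^-1` `]0%R, +oo[))%E.
    by apply: probability_setC; exact: mxi.
  have -> : P (xis k @^-1` `]0, +oo[) = 1%E.
    rewrite -xi_pos; transitivity (distribution P xi `]0, +oo[).
      exact: xis_copies.
    congr (P _); apply/seteqP; split => w /=; rewrite in_itv/= andbT //.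
  by rewrite subee.
have mA2 : measurable A2.
  rewrite (_ : A2 = \bigcap_(k in [set k | (k < N)%N]) (xis k @^-1` `]-oo, x])).
    by apply: fin_bigcap_measurable => [|k _]; [exact: finite_II|exact: mxi].
  by apply/seteqP; split => w hw k kN; have := hw k kN; rewrite /= in_itv.
have tail01 : 0 <= tail xi x <= 1.
  rewrite /tail fine_ge0//= -lee_fin fineK ?probability_le1 ?fin_num_measure//;
    exact: measurable_tail_event.
have PA2 : (P A2 <= (eta / 2)%:E)%E.
  have -> : A2 = [set w | forall k, (k < N)%N -> (`]-oo, x]%classic : set R) (xis k w)].
    by apply/seteqP; split => w hw k kN; have := hw k kN; rewrite /= in_itv.
  rewrite (iid_probability xis_copies xis_indep N
    (B := fun=> `]-oo, x]%classic))// lee_fin.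
  have -> : fine (P (xi @^-1` `]-oo, x])) = 1 - tail xi x.
    rewrite (_ : _ @^-1` _ = ~` [set w | x < xi w]).
      rewrite probability_setC ?fineB//.
        exact: fin_num_measure (measurable_tail_event _ _).
      exact: measurable_tail_event.
    apply/seteqP; split => w /=; rewrite in_itv/= leNgt; first exact/negP.
    by move=> /negP.
  rewrite prodr_const card_ord; apply: le_trans hK.
  apply: (@le_trans _ _ (expR (- tail xi x) ^+ N)).
    case/andP: tail01 => p0 p1; rewrite lerXn2r ?nnegrE ?subr_ge0 ?expR_ge0//.
    exact: expR_ge1Dx.
  rewrite -expRM_natl ler_expR; case/andP: tail01 => p0 p1.
  have : tail xi x * (K * L x - 1) <= tail xi x * N%:R.
    by apply: ler_wpM2l => //; move: N2; rewrite -natr1; lra.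
  have : K * (1 / 2) <= K * (tail xi x * L x).
    by apply: ler_wpM2l; [exact: ltW|move: pL; lra].
  by lra.
have mA3 : measurable A3.
  rewrite (_ : A3 = (fun w => \sum_(k < N) truncation x (xis k w)) @^-1` `]x / 2, +oo[).
    rewrite -[X in measurable X]setTI; apply: measurable_sum => // k.
    exact: (measurableT_comp (measurable_truncation x)).
  by apply/seteqP; split => w /=; rewrite in_itv/= andbT.
have PA3 : (P A3 <= (eta / 2)%:E)%E.
  apply: le_trans (truncated_walk_markov xis_copies N x0) _.
  rewrite lee_fin.
  have tx : 0 <= truncated_mean xi x / x by rewrite divr_ge0 ?truncated_mean_ge0// ltW.
  have h1 : N%:R * (truncated_mean xi x / x) <= K * L x * (truncated_mean xi x / x).
    exact: ler_wpM2r.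
  have h2 : truncated_mean xi x * L x / x * K <= eta / 4.
    by rewrite -ler_pdivlMr//; move: tmL; lra.
  by move: h1 h2; lra.
exists (A1 `&` ~` A2 `&` ~` A3); split.
- apply: measurableI; last exact: measurableC.
  by apply: measurableI => //; exact: measurableC.
- rewrite !setCI !setCK; apply: le_trans (measureU2 _ _ _) _ => //.
    by apply: measurableU => //; exact: measurableC.
  rewrite [eta]splitr EFinD; apply: leeD => //.
  apply: le_trans (measureU2 _ _ _) _ => //; first exact: measurableC.
  by rewrite [X in (X + _)%E]PA1 add0e.
- move=> w [[pos /existsNP[k0 /not_implyP[k0N /negP xk0]]] /negP].
  rewrite -leNgt => sumx.
  have ex : exists k, x < xis k w by exists k0; rewrite ltNge.
  pose m := ex_minn ex.
  have [xm small] : x < xis m w /\ forall k, (k < m)%N -> xis k w <= x.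
    rewrite /m; case: ex_minnP => j xj hj; split => // k kj.
    by rewrite leNgt; apply/negP => /hj; rewrite leqNgt kj.
  have mN : (m <= N)%N.
    rewrite ltnW// (leq_ltn_trans _ k0N)// /m; case: ex_minnP => j _; apply.
    by rewrite ltNge.
  have Smx : random_walk (fun k => xis k : T -> R) m w <= x / 2.
    exact: le_trans (random_walk_truncation pos mN small) sumx.
  exists m; split => //.
  rewrite (shot_noise_large_jump pos h_ge0 _ xm)/=; last first.
    by apply: le_trans Smx _; rewrite ler_pdivrMr// ler_peMr ?ler1n// ltW.
  have bnd (k : 'I_m.+1) :
      (1 - delta) * h x <= h (x - random_walk (fun k => xis k : T -> R) k w)
        <= (1 + delta) * h x.
    have Sk0 : 0 <= random_walk (fun k => xis k : T -> R) k w.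
      exact: (random_walk_ge0 (xi := fun k => xis k : T -> R)).
    have Skx : random_walk (fun k => xis k : T -> R) k w <= x / 2.
      apply: le_trans Smx.
      by apply: (random_walk_nd (xi := fun k => xis k : T -> R) pos); rewrite -ltnS.
    have := hunif (x - random_walk (fun k => xis k : T -> R) k w).
    rewrite ler_norml; case/(_ _)/andP => [|p q]; apply/andP; split; lra.
  have cE (c : R) : c * (m.+1%:R * h x) = \sum_(k < m.+1) c * h x.
    by rewrite mulrCA mulr_natl sumr_const card_ord.
  rewrite !cE.
  by apply/andP; split; apply: ler_sum => k _; have /andP[] := bnd k.
Unshelve. all: by end_near.
Qed.

End single_level.

(** * Exceedance times of several levels *)

(** The power is squeezed by 1 - p <= exp(- p) and, applying 1 + z <= exp(z) to z = p / (1 - p), by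
    1 - p >= exp(- p / (1 - p)). *)
Lemma expr_1B_cvg (R : realType) (p : R -> R) (N : R -> nat) (c : R) :
  (\forall t \near +oo, 0 <= p t) -> p t @[t --> +oo] --> 0 ->
  (N t)%:R * p t @[t --> +oo] --> c ->
  (1 - p t) ^+ N t @[t --> +oo] --> expR (- c).
Proof.
move=> p_ge0 p0 Npc.
have h1 : expR (- ((N t)%:R * p t)) @[t --> +oo] --> expR (- c).
  by apply: (cvg_comp _ _ (cvgN Npc)); exact: continuous_expR.
have h2 : expR (- ((N t)%:R * p t / (1 - p t))) @[t --> +oo] --> expR (- c).
  have hc : (N t)%:R * p t / (1 - p t) @[t --> +oo] --> c / (1 - 0).
    apply: cvgM => //; apply: cvgV; first by rewrite subr0.
    by apply: cvgB => //; exact: cvg_cst.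
  rewrite subr0 divr1 in hc.
  by apply: (cvg_comp _ _ (cvgN hc)); exact: continuous_expR.
apply: (squeeze_cvgr _ h2 h1).
have /cvgrPdist_lt/(_ (1 / 2)) := p0; rewrite divr_gt0// => /(_ isT) n1.
near=> t.
have pt0 : 0 <= p t by near: t; exact: p_ge0.
have : `|0 - p t| < 1 / 2 by near: t; exact: n1.
rewrite ltr_norml => /andP[pt1 _].
have q0 : 0 < 1 - p t by lra.
apply/andP; split; last first.
  rewrite -mulrN expRM_natl lerXn2r ?nnegrE ?expR_ge0 ?(ltW q0)//.
  exact: expR_ge1Dx.
rewrite -mulrA -mulrN expRM_natl lerXn2r ?nnegrE ?expR_ge0 ?(ltW q0)//.
rewrite expRN -[leRHS]invrK lef_pV2 ?posrE ?expR_gt0 ?invr_gt0//.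
apply: le_trans (expR_ge1Dx _).
by have -> : 1 + p t / (1 - p t) = (1 - p t)^-1 by field; rewrite gt_eqF.
Unshelve. all: by end_near.
Qed.

Section first_exceedances.
Context (R : realType) (n : nat) (u s : 'I_n -> R).
Hypotheses (s_ge0 : forall i, 0 <= s i).

(** This is the discrete counterpart of the length of [first_level s j]: it counts the steps for
    which level [j] is the lowest one imposed. Truncated subtraction plays the part of the maximum
    with 0. *)
Definition level_count (t : R) (j : 'I_n) : nat :=
  (Num.truncn (t * s j) - \max_(i < n | (i < j)%N) Num.truncn (t * s i))%N.

Lemma level_count_cvg (j : 'I_n) :
  (level_count t j)%:R / t @[t --> +oo] --> Num.max 0 (s j - previous_max s j).
Proof.
apply/cvgrPdist_le => e e0; near=> t.
have t0 : 0 < t by [].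
(* Rounding changes the count by at most 1, which becomes at most [e] after division by [t]. *)
have te : 1 <= e * t by rewrite -ler_pdivrMl// mulr1.
have tr i : (Num.truncn (t * s i))%:R <= t * s i < (Num.truncn (t * s i)).+1%:R.
  by apply: truncn_itv; rewrite mulr_ge0// ltW.
set b := previous_max s j.
pose M := (\max_(i < n | (i < j)%N) Num.truncn (t * s i))%N.
have b0 : 0 <= b by apply: bigmax_ge_id.
have Mb : M%:R <= t * b.
  rewrite /M; elim/big_ind: _ => [|p q hp hq|i ij]; first by rewrite mulr_ge0// ltW.
    by rewrite /maxn; case: ifP.
  have /andP[h _] := tr i; apply: le_trans h _; rewrite ler_pM2l//.
  exact: (le_bigmax_cond _ (P := fun i : 'I_n => (i < j)%N)).
have bM : t * b <= M.+1%:R.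
  rewrite -ler_pdivlMl//; apply/bigmax_leP; split => [|i ij].
    by rewrite mulr_ge0// invr_ge0 ltW.
  rewrite ler_pdivlMl//; have /andP[_ /ltW h] := tr i; apply: le_trans h _.
  rewrite ler_nat ltnS.
  exact: (leq_bigmax_cond (P := fun i : 'I_n => (i < j)%N)
    (F := fun i => Num.truncn (t * s i))).
have /andP[K1 K2] := tr j; rewrite -natr1 in K2; rewrite -natr1 in bM.
have -> : Num.max 0 (s j - b) - (level_count t j)%:R / t =
    (t * Num.max 0 (s j - b) - (level_count t j)%:R) / t by field; rewrite gt_eqF.
rewrite normrM [`|t^-1|]gtr0_norm ?invr_gt0// ler_pdivrMr//; apply: le_trans te.
rewrite /level_count -/M; set K := Num.truncn (t * s j) in K1 K2 *.
rewrite maxr_pMr ?(ltW t0)// mulr0 mulrBr ler_norml.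
have [KM|MK] := leqP K M.
  have -> : (K - M = 0)%N by apply/eqP; rewrite subn_eq0.
  have : K%:R <= M%:R :> R by rewrite ler_nat.
  by rewrite subr0; case: (leP 0 (t * s j - t * b)) => ? ?; apply/andP; split; lra.
have : M.+1%:R <= K%:R :> R by rewrite ler_nat.
rewrite natrB ?(ltnW MK)// -natr1.
by case: (leP 0 (t * s j - t * b)) => ? ?; apply/andP; split; lra.
Unshelve. all: by end_near.
Qed.

End first_exceedances.

Lemma cvg_prodr (R : realType) (T : Type) (F : set_system T) (I : Type)
    (r : seq I) (f : I -> T -> R) (l : I -> R) : Filter F ->
  (forall i, f i x @[x --> F] --> l i) ->
  (\prod_(i <- r) f i x) @[x --> F] --> \prod_(i <- r) l i.
Proof.
move=> FF fl; elim: r => [|i r ih].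
  by rewrite big_nil; under eq_fun do rewrite big_nil; exact: cvg_cst.
rewrite big_cons; under eq_fun do rewrite big_cons.
by apply: cvgM => //; exact: fl.
Qed.

Section exceedance_times.
Context (d : measure_display) (T : measurableType d) (R : realType)
  (P : probability T R) (xi : {RV P >-> R}) (xis : nat -> {RV P >-> R})
  (L Linv : R -> R).
Hypotheses (xis_copies : forall i (B : set R), measurable B ->
     distribution P (xis i) B = distribution P xi B)
  (xis_indep : independent_family P (fun i => xis i : T -> R))
  (L_ge0 : forall x, 0 <= x -> 0 <= L x)
  (L_nd : forall x y, 0 <= x -> x <= y -> L x <= L y)
  (Linv_ge0 : forall t, 0 <= t -> 0 <= Linv t)
  (LinvK : forall t, 0 <= t -> L (Linv t) = t)
  (L_tail : asymp_equiv (tail xi) (fun x => 1 / L x)).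

Lemma Linv_cvgy : Linv t @[t --> +oo] --> +oo.
Proof.
apply/cvgryPge => M; near=> t.
rewrite leNgt; apply/negP => tM.
have t0 : 0 <= t by [].
have tL : L M < t by near: t; exact: nbhs_pinfty_gt (num_real _).
have : L (Linv t) <= L M by rewrite L_nd ?Linv_ge0// ltW.
by rewrite LinvK// leNgt tL.
Unshelve. all: by end_near.
Qed.

Lemma Linv_nd t t' : 0 <= t -> 0 <= t' -> t < t' -> Linv t <= Linv t'.
Proof.
move=> t0 t'0 tt'; rewrite leNgt; apply/negP => lt.
have : L (Linv t') <= L (Linv t) by rewrite L_nd ?Linv_ge0// ltW.
by rewrite !LinvK// leNgt tt'.
Qed.

Lemma Linv_scale_cvgy (u : R) : 0 < u -> Linv (t * u) @[t --> +oo] --> +oo.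
Proof.
move=> u0; apply: (cvg_comp _ _ _ Linv_cvgy).
by rewrite -[u]invrK; apply: divr_cvgy; rewrite invr_gt0.
Qed.

Lemma tail_Linv_cvg (u : R) : 0 < u ->
  tail xi (Linv (t * u)) * t @[t --> +oo] --> u^-1.
Proof.
move=> u0.
have h : (tail xi (Linv (t * u)) * L (Linv (t * u))) / u @[t --> +oo] --> 1 / u.
  apply: cvgM; last exact: cvg_cst.
  exact: (cvg_comp _ _ (Linv_scale_cvgy u0) (tail_mul_cvg L_tail)).
rewrite div1r in h; apply: cvg_trans h; apply: near_eq_cvg; near=> t.
by rewrite LinvK ?mulr_ge0 ?(ltW u0)//; field; rewrite gt_eqF.
Unshelve. all: by end_near.
Qed.

Lemma tail_cvg0 (u : R) : 0 < u -> tail xi (Linv (t * u)) @[t --> +oo] --> (0 : R).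
Proof.
move=> u0.
have h : (tail xi (Linv (t * u)) * t) * t^-1 @[t --> +oo] --> u^-1 * 0.
  apply: cvgM (tail_Linv_cvg u0) _.
  apply/cvgrPdist_le => e e0; near=> t.
  have t0 : 0 < t by [].
  by rewrite sub0r normrN gtr0_norm ?invr_gt0// -[leRHS]invrK lef_pV2 ?posrE ?invr_gt0.
rewrite mulr0 in h; apply: cvg_trans h; apply: near_eq_cvg; near=> t.
by rewrite mulfK// gt_eqF.
Unshelve. all: by end_near.
Qed.

Context (n : nat) (u s : 'I_n -> R).
Hypotheses (u_gt0 : forall i, 0 < u i)
  (u_incr : forall i j : 'I_n, (i < j)%N -> u i < u j)
  (s_ge0 : forall i, 0 <= s i).

(* For all [i], the first index [k >= 1] of a step larger than [Linv (t * u i)]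
   is larger than [t * s i]. *)
Definition late_exceedances (t : R) (r : 'I_n -> R) : set T :=
  [set w | forall i k, k.+1%:R <= t * r i -> xis k w <= Linv (t * u i)].

(** Among the levels imposed on step [k], the one of least index is the lowest and implies the
    others. The product over independent steps is then regrouped by this binding level. *)
Lemma late_exceedances_probability (t : R) : 0 <= t ->
  measurable (late_exceedances t s) /\
  P (late_exceedances t s) =
  (\prod_(j < n) (1 - tail xi (Linv (t * u j))) ^+ level_count s t j)%:E.
Proof.
move=> t0; pose K i := Num.truncn (t * s i).
pose B k := \bigcap_(i in [set i : 'I_n | (k < K i)%N]) [set` `]-oo, Linv (t * u i)]].
have mB k : measurable (B k : set R).
  by apply: fin_bigcap_measurable => // i _; exact: measurable_itv.
pose Kmax := (\max_(i < n) K i)%N.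
have KE k i : (k.+1%:R <= t * s i) = (k < K i)%N.
  by rewrite /K truncn_ge_nat ?mulr_ge0.
have lateE : late_exceedances t s =
    [set w | forall k, (k < Kmax)%N -> B k (xis k w)].
  apply/seteqP; split => w hw.
    by move=> k _ i ki; rewrite /= in_itv/= hw// KE.
  move=> i k; rewrite KE => ki.
  have kK : (k < Kmax)%N by apply: leq_trans ki _; exact: (leq_bigmax (F := K)).
  by have := hw k kK i ki; rewrite /= in_itv.
split.
  rewrite lateE (_ : [set w | _] =
    \bigcap_(k in [set k | (k < Kmax)%N]) (xis k @^-1` B k))//.
  apply: fin_bigcap_measurable => [|k _]; first exact: finite_II.
  by rewrite -[X in measurable X]setTI; exact: measurable_funPT.
rewrite lateE (iid_probability xis_copies xis_indep Kmax mB); congr EFin.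
(* Level [j] is the binding one for step [k]. At most one [j] qualifies; if none does, the step is
   unconstrained and the empty product is 1. *)
pose first_at (k : nat) (j : 'I_n) :=
  (k < K j)%N && [forall i : 'I_n, (i < j)%N ==> (K i <= k)%N].
have PB k : fine (P (xi @^-1` B k)) =
    \prod_(j < n | first_at k j) (1 - tail xi (Linv (t * u j))).
  have [[i ki]|nk] := pselect (exists i, (k < K i)%N).
    have [j kj jmin] :=
      arg_minnP (P := fun i : 'I_n => (k < K i)%N) (fun i : 'I_n => i : nat) ki.
    have fj : first_at k j.
      rewrite /first_at kj; apply/forallP => l; apply/implyP => lj.
      by rewrite leqNgt; apply/negP => /jmin; rewrite leqNgt lj.
    rewrite (bigD1 j)//= big1 ?mulr1; last first.
      move=> l /andP[/andP[kl /forallP hl] lj]; exfalso.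
      have := jmin _ kl; rewrite leq_eqVlt => /orP[/eqP jl|jl].
        by move/eqP: lj; apply; exact: val_inj.
      by have := hl j; rewrite jl/= leqNgt kj.
    have -> : xi @^-1` B k = ~` [set w | Linv (t * u j) < xi w].
      apply/seteqP; split => w /=.
        by move=> /(_ j kj); rewrite /= in_itv/= leNgt => /negP.
      move=> /negP; rewrite -leNgt => xj l kl; rewrite /= in_itv/=.
      apply: le_trans xj _.
      have := jmin _ kl; rewrite leq_eqVlt => /orP[/eqP/val_inj ->//|jl].
      have [->|tN0] := eqVneq t 0; first by rewrite !mul0r.
      have {}t0 : 0 < t by rewrite lt0r tN0.
      apply: Linv_nd; rewrite ?mulr_ge0 ?(ltW t0) ?(ltW (u_gt0 _))//.
      by rewrite ltr_pM2l// u_incr.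
    rewrite probability_setC; last exact: measurable_tail_event.
    by rewrite fineB// fin_num_measure//; exact: measurable_tail_event.
  rewrite big_pred0; last first.
    by move=> j; apply/negbTE/negP => /andP[kj _]; apply: nk; exists j.
  rewrite (_ : _ @^-1` _ = setT) ?probability_setT//.
  by apply/seteqP; split => // w _ i ki; exfalso; apply: nk; exists i.
under eq_bigr do rewrite PB.
rewrite (exchange_big_dep xpredT)//=; apply: eq_bigr => j _.
rewrite -(big_mkord (fun k => first_at k j) (fun=> 1 - tail xi (Linv (t * u j)))).
rewrite /level_count -/(K j) -prodr_const_nat.
rewrite [RHS](big_nat_widen _ _ Kmax)/=; last exact: (leq_bigmax (F := K)).
rewrite [RHS](big_nat_widenl _ 0)//; apply: eq_bigl => k.
rewrite /first_at; congr (_ && _).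
apply/forallP/bigmax_leqP => h i; last by apply/implyP; exact: h.
by move=> ij; have := h i; rewrite ij.
Qed.

Lemma late_exceedances_cvg :
  fine (P (late_exceedances t s)) @[t --> +oo] --> expR (- staircase_mass u s).
Proof.
have h : \prod_(j < n) (1 - tail xi (Linv (t * u j))) ^+ level_count s t j @[t --> +oo]
    --> \prod_(j < n) expR (- (Num.max 0 (s j - previous_max s j) / u j)).
  apply: cvg_prodr => j; apply: expr_1B_cvg.
  - by apply: nearW => t; rewrite /tail fine_ge0.
  - exact: tail_cvg0.
  - have hj : (level_count s t j)%:R / t * (tail xi (Linv (t * u j)) * t)
        @[t --> +oo] --> Num.max 0 (s j - previous_max s j) / u j.
      by apply: cvgM; [exact: level_count_cvg|exact: tail_Linv_cvg].
    apply: cvg_trans hj; apply: near_eq_cvg; near=> t.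
    have t0 : 0 < t by [].
    by field; rewrite gt_eqF.
rewrite /staircase_mass -sumrN expR_sum; apply: cvg_trans h; apply: near_eq_cvg.
near=> t; have t0 : 0 <= t by [].
by have [_ ->] := late_exceedances_probability t0.
Unshelve. all: by end_near.
Qed.

End exceedance_times.

(** Homogeneity reduces the effect of multiplying all thresholds by a factor close to 1 to
    continuity of the exponential in one real variable. *)
Lemma staircase_mass_scale (R : realType) (n : nat) (u s : 'I_n -> R) (c : R) :
  0 <= c -> staircase_mass u (fun i => c * s i) = c * staircase_mass u s.
Proof.
move=> c0; rewrite /staircase_mass mulr_sumr; apply: eq_bigr => j _.
have -> : previous_max (fun i => c * s i) j = c * previous_max s j.
  by rewrite /previous_max (big_morph _ (fun y z => maxr_pMr y z c0) (mulr0 c)).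
by rewrite -mulrBr mulrA maxr_pMr// mulr0.
Qed.

Lemma staircase_mass0 (R : realType) (n : nat) (u : 'I_n -> R) :
  staircase_mass u (fun=> 0) = 0.
Proof.
have := staircase_mass_scale u (fun=> 0) (lexx (0 : R)).
by rewrite !mul0r.
Qed.

Lemma measurable_shot_noise (d : measure_display) (T : measurableType d)
    (R : realType) (xis : nat -> T -> R) (h : R -> R) (x : R) :
  (forall k, measurable_fun setT (xis k)) ->
  (forall y, 0 <= y -> 0 <= h y) ->
  measurable_fun `[(0 : R), +oo[ h ->
  measurable_fun setT (shot_noise xis h x).
Proof.
move=> mxis h0 mh; apply: ge0_emeasurable_sum => [k w _ _|k _].
  by rewrite lee_fin; case: ifPn => // ?; rewrite h0// subr_ge0.
apply/measurable_EFinP.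
(* Extending [h] by 0 to the negative half-line encodes the test on the walk and gives a function
   measurable on the whole line. *)
rewrite (_ : (fun w => _) =
  (h \_ `[(0 : R), +oo[) \o (fun w => x - random_walk xis k w)).
  apply: measurableT_comp.
    by apply/(measurable_restrictT _ _).1.
  by apply: measurable_funB => //; exact: measurable_sum.
apply/funext => w /=; rewrite patchE; case: ifPn => Sx.
  by rewrite mem_set//= in_itv/= andbT subr_ge0.
by rewrite memNset//= in_itv/= andbT subr_ge0; exact/negP.
Qed.

(** * Joint survival function of the normalized shot noise *)

Section all_levels.
Context (d : measure_display) (T : measurableType d) (R : realType)
  (P : probability T R) (xi : {RV P >-> R}) (xis : nat -> {RV P >-> R})
  (L Linv h : R -> R) (alpha : R).
Hypotheses (xi_pos : P [set w | 0 < xi w] = 1%E)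
  (xis_copies : forall i (B : set R), measurable B ->
     distribution P (xis i) B = distribution P xi B)
  (xis_indep : independent_family P (fun i => xis i : T -> R))
  (L_ge0 : forall x, 0 <= x -> 0 <= L x)
  (L_nd : forall x y, 0 <= x -> x <= y -> L x <= L y)
  (L_slow : slowly_varying L)
  (L_infty : L x @[x --> +oo] --> +oo)
  (Linv_ge0 : forall t, 0 <= t -> 0 <= Linv t)
  (LinvK : forall t, 0 <= t -> L (Linv t) = t)
  (LK : forall t, 0 <= t -> Linv (L t) = t)
  (h_ge0 : forall x, 0 <= x -> 0 <= h x)
  (h_meas : measurable_fun `[(0 : R), +oo[ h)
  (h_regular : regularly_varying (h \o Linv) alpha)
  (L_tail : asymp_equiv (tail xi) (fun x => 1 / L x)).

Let Y (t u : R) (w : T) : R :=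
  fine (shot_noise (fun k => xis k : T -> R) h (Linv (t * u)) w) / (t * h (Linv t)).

(** One factor [1 +- delta] comes from replacing the shot noise by [m.+1 * h (Linv (t * u))], the
    other from replacing [h (Linv (t * u)) / h (Linv t)] by [u ^ alpha]. *)
Lemma normalized_first_jump (u delta eta : R) : 0 < u -> 0 < delta < 1 -> 0 < eta ->
  \forall t \near +oo, exists G : set T, [/\ measurable G, (P (~` G) <= eta%:E)%E &
    forall w, G w -> exists m : nat,
      [/\ forall k, (k < m)%N -> xis k w <= Linv (t * u), Linv (t * u) < xis m w &
        (1 - delta) ^+ 2 * (m.+1%:R / t) <= Y t u w / u `^ alpha
          <= (1 + delta) ^+ 2 * (m.+1%:R / t)]].
Proof.
move=> u0 /andP[d0 d1] eta0.
have n1 := Linv_scale_cvgy L_nd Linv_ge0 LinvK u0 (shot_noise_first_jump xi_pos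
  xis_copies xis_indep L_ge0 L_nd L_slow L_infty LK h_ge0 h_regular L_tail d0 eta0).
have [_ _ hpos hreg] := h_regular.
have a0 : 0 < u `^ alpha by rewrite powR_gt0.
have da0 : 0 < delta * u `^ alpha by rewrite mulr_gt0.
have /cvgrPdist_le/(_ _ da0) n2 := hreg _ u0.
near=> t.
have t0 : 0 < t by [].
have ht : 0 < h (Linv t) by near: t; exact: hpos.
have [G [mG PG hG]] : exists G : set T, [/\ measurable G, (P (~` G) <= eta%:E)%E &
    forall w, G w -> exists m,
      first_jump_approximation xis h delta (Linv (t * u)) w m] by near: t; exact: n1.
have : `|u `^ alpha - (h \o Linv) (u * t) / (h \o Linv) t| <= delta * u `^ alpha.
  by near: t; exact: n2.
rewrite /= [u * t]mulrC ler_norml; set r := _ / _ => /andP[r1 r2].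
exists G; split => // w /hG[m [small large /andP[Y1 Y2]]]; exists m; split => //.
have hE : h (Linv (t * u)) = r * h (Linv t) by rewrite /r; field; rewrite gt_eqF.
have m0 : 0 <= m.+1%:R / t :> R by rewrite divr_ge0// ltW.
have YE (c : R) : c * (m.+1%:R * h (Linv (t * u))) / (t * h (Linv t)) =
    c * (m.+1%:R / t) * r by rewrite hE; field; rewrite !gt_eqF.
have th0 : 0 < t * h (Linv t) by rewrite mulr_gt0.
rewrite ler_pdivlMr// ler_pdivrMr//; apply/andP; split.
  apply: (@le_trans _ _ ((1 - delta) * (m.+1%:R / t) * r)); last first.
    by rewrite -YE ler_pM2r ?invr_gt0.
  rewrite [leLHS](_ : _ =
    (1 - delta) * (m.+1%:R / t) * ((1 - delta) * u `^ alpha)); last by ring.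
  apply: ler_wpM2l; first by rewrite mulr_ge0// subr_ge0 ltW.
  by move: r2; lra.
apply: (@le_trans _ _ ((1 + delta) * (m.+1%:R / t) * r)).
  by rewrite -YE ler_pM2r ?invr_gt0.
rewrite [leRHS](_ : _ =
  (1 + delta) * (m.+1%:R / t) * ((1 + delta) * u `^ alpha)); last by ring.
apply: ler_wpM2l; first by rewrite mulr_ge0// addr_ge0// ltW.
by move: r1; lra.
Unshelve. all: by end_near.
Qed.

Context (n : nat) (u s : 'I_n -> R).
Hypotheses (u_gt0 : forall i, 0 < u i)
  (u_incr : forall i j : 'I_n, (i < j)%N -> u i < u j)
  (s_ge0 : forall i, 0 <= s i).

(** Outside an event of small probability, the event in question lies between late-exceedance events
    whose thresholds are divided by [(1 - delta) ^+ 2] and [(1 + delta) ^+ 2]. Their limits approach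
    the claimed one as [delta] tends to 0, so [delta] is fixed before [t]. *)
Lemma shot_noise_survival_cvg :
  fine (P [set w | forall i, s i < Y t (u i) w]) @[t --> +oo] -->
  expR (- staircase_mass u (fun i => s i / u i `^ alpha)).
Proof.
pose r i := s i / u i `^ alpha; rewrite -/r.
have a0 i : 0 < u i `^ alpha by rewrite powR_gt0.
have r0 i : 0 <= r i by rewrite divr_ge0// ltW.
apply/cvgrPdist_le => e e0; have e4 : 0 < e / 4 by rewrite divr_gt0.
(* The exceptional events of the [n] levels are joined by a union bound; [n.+1] avoids dividing by
   0. *)
have en : 0 < e / 4 / n.+1%:R by rewrite divr_gt0.
set m := staircase_mass u r.
have contE (f : R -> R) : f delta @[delta --> 0^'+] --> (1 : R) ->
    expR (- (f delta * m)) @[delta --> 0^'+] --> expR (- m).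
  move=> f1; have : - (f delta * m) @[delta --> 0^'+] --> - (1 * m).
    by apply: cvgN; apply: cvgM => //; exact: cvg_cst.
  by rewrite mul1r => h1; apply: (cvg_comp _ _ h1); exact: continuous_expR.
have inv_sq (f : R -> R) : f delta @[delta --> 0^'+] --> (1 : R) ->
    (f delta ^+ 2)^-1 @[delta --> 0^'+] --> (1 : R).
  move=> f1; have f2 : (f delta * f delta)^-1 @[delta --> 0^'+] --> (1 * 1 : R)^-1.
    by apply: cvgV; [rewrite mulr1 oner_neq0|exact: cvgM].
  by rewrite mulr1 invr1 in f2.
have c1 : ((1 + delta) ^+ 2)^-1 @[delta --> 0^'+] --> (1 : R).
  apply: inv_sq; have h1 : 1 + delta @[delta --> 0^'+] --> (1 + 0 : R).
    by apply: cvgD; [exact: cvg_cst|exact/cvg_at_right_filter/cvg_id].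
  by rewrite addr0 in h1.
have c2 : ((1 - delta) ^+ 2)^-1 @[delta --> 0^'+] --> (1 : R).
  apply: inv_sq; have h1 : 1 - delta @[delta --> 0^'+] --> (1 - 0 : R).
    by apply: cvgB; [exact: cvg_cst|exact/cvg_at_right_filter/cvg_id].
  by rewrite subr0 in h1.
have /cvgrPdist_le/(_ _ e4) m1 := contE _ c1.
have /cvgrPdist_le/(_ _ e4) m2 := contE _ c2.
have [delta [/andP[d0 d1] hp hm]] : exists delta : R, [/\ 0 < delta < 1,
    `|expR (- m) - expR (- (((1 + delta) ^+ 2)^-1 * m))| <= e / 4 &
    `|expR (- m) - expR (- (((1 - delta) ^+ 2)^-1 * m))| <= e / 4].
  near (0 : R)^'+ => delta; exists delta; split.
  - by apply/andP; split.
  - by near: delta; exact: m1.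
  - by near: delta; exact: m2.
have late c : 0 <= c ->
    fine (P (late_exceedances xis Linv u t (fun i => c * r i))) @[t --> +oo]
      --> expR (- (c * m)).
  move=> c0; rewrite -staircase_mass_scale//.
  apply: (late_exceedances_cvg xis_copies xis_indep L_nd Linv_ge0 LinvK L_tail) => // i.
  by rewrite mulr_ge0.
have cp0 : 0 < (1 + delta) ^+ 2 by rewrite exprn_gt0// addr_gt0.
have cm0 : 0 < (1 - delta) ^+ 2 by rewrite exprn_gt0// subr_gt0.
have cp0' : 0 <= ((1 + delta) ^+ 2)^-1 by rewrite invr_ge0 ltW.
have cm0' : 0 <= ((1 - delta) ^+ 2)^-1 by rewrite invr_ge0 ltW.
have /cvgrPdist_le/(_ _ e4) lp := late _ cp0'.
have /cvgrPdist_le/(_ _ e4) lm := late _ cm0'.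
have nG : \forall t \near +oo, forall i : 'I_n, exists G : set T,
  [/\ measurable G, (P (~` G) <= (e / 4 / n.+1%:R)%:E)%E &
    forall w, G w -> exists m : nat,
      [/\ forall k, (k < m)%N -> xis k w <= Linv (t * u i), Linv (t * u i) < xis m w &
        (1 - delta) ^+ 2 * (m.+1%:R / t) <= Y t (u i) w / u i `^ alpha
          <= (1 + delta) ^+ 2 * (m.+1%:R / t)]].
  by apply: filter_forall => i; apply: normalized_first_jump => //; rewrite d0.
pose E t c := late_exceedances xis Linv u t (fun i => c * r i).
near=> t.
have t0 : 0 < t by [].
set A := [set w | _].
have hlp : `|expR (- (((1 + delta) ^+ 2)^-1 * m)) -
    fine (P (E t ((1 + delta) ^+ 2)^-1))| <= e / 4.
  by near: t; exact: lp.
have hlm : `|expR (- (((1 - delta) ^+ 2)^-1 * m)) -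
    fine (P (E t ((1 - delta) ^+ 2)^-1))| <= e / 4.
  by near: t; exact: lm.
have /choice[G hG] : forall i : 'I_n, exists G : set T,
  [/\ measurable G, (P (~` G) <= (e / 4 / n.+1%:R)%:E)%E &
    forall w, G w -> exists m : nat,
      [/\ forall k, (k < m)%N -> xis k w <= Linv (t * u i), Linv (t * u i) < xis m w &
        (1 - delta) ^+ 2 * (m.+1%:R / t) <= Y t (u i) w / u i `^ alpha
          <= (1 + delta) ^+ 2 * (m.+1%:R / t)]] by near: t; exact: nG.
pose B := \big[setU/set0]_(i < n) ~` G i.
have mB : measurable B.
  by apply: bigsetU_measurable => i _; apply: measurableC; have [] := hG i.
have PB : fine (P B) <= e / 4.
  have [_ PB] : measurable B /\ (P B <= (\sum_(i < n) e / 4 / n.+1%:R)%:E)%E.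
    rewrite /B; elim/big_ind2: _ => [|S x S' y [mS PS] [mS' PS']|i _].
    - by split => //; rewrite measure0.
    - split; first exact: measurableU.
      by apply: le_trans (measureU2 _ mS mS') _; rewrite EFinD; exact: leeD.
    - by have [mG PG _] := hG i; split => //; exact: measurableC.
  rewrite -lee_fin fineK ?fin_num_measure//; apply: le_trans PB _.
  rewrite lee_fin sumr_const card_ord -[leLHS]mulr_natl mulrCA -[leRHS]mulr1.
  by apply: ler_wpM2l; [exact: ltW|rewrite ler_pdivrMr// mul1r ler_nat].
have mE c : 0 <= c -> measurable (E t c).
  move=> c0; have cr i : 0 <= c * r i by rewrite mulr_ge0.
  by have [] := late_exceedances_probability xis_copies xis_indep L_nd Linv_ge0
    LinvK u_gt0 u_incr cr (ltW t0).
have mA : measurable A.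
  rewrite (_ : A = \bigcap_(i in [set: 'I_n]) ((Y t (u i)) @^-1` `]s i, +oo[)).
    apply: fin_bigcap_measurable => // i _; rewrite -[X in measurable X]setTI.
    apply: measurable_funM => //; apply: measurableT_comp => //.
    exact: measurable_shot_noise.
  apply/seteqP; split => w hw i; first by rewrite /= in_itv/= hw.
  by have := hw i Logic.I; rewrite /= in_itv/= andbT.
have subU (S S' : set T) : measurable S -> measurable S' -> S `<=` S' `|` B ->
    fine (P S) <= fine (P S') + e / 4.
  move=> mS mS' sub; apply: (@le_trans _ _ (fine (P S') + fine (P B))).
    rewrite -lee_fin EFinD !fineK ?fin_num_measure//.
    apply: le_trans (measureU2 _ mS' mB).
    by apply: le_measure; rewrite ?inE//; exact: measurableU.
  by rewrite lerD2l.
have GB w : ~ B w -> forall i, G i w.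
  by move=> nB i; apply: contrapT => nG'; apply: nB; rewrite /B (bigD1 i)//=; left.
have scale q y z : 0 < q -> (t * (q^-1 * z) < y) = (z < q * (y / t)).
  by move=> q0; rewrite mulrCA ltr_pdivrMl// [in RHS]mulrA ltr_pdivlMr// [t * z]mulrC.
have AE : A `<=` E t ((1 + delta) ^+ 2)^-1 `|` B.
  move=> w Aw; have [Bw|/GB Gw] := pselect (B w); [by right|left => i k].
  have [_ _ /(_ _ (Gw i))[j [small _ /andP[_ Yj]]]] := hG i.
  have : r i < Y t (u i) w / u i `^ alpha by rewrite ltr_pM2r ?invr_gt0//; exact: Aw.
  move=> /lt_le_trans/(_ Yj); rewrite -scale// => rj kr; apply: small.
  by rewrite -ltnS -(ltr_nat R); exact: le_lt_trans rj.
have EA : E t ((1 - delta) ^+ 2)^-1 `<=` A `|` B.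
  move=> w Ew; have [Bw|/GB Gw] := pselect (B w); [by right|left => i].
  have [_ _ /(_ _ (Gw i))[j [_ large /andP[Yj _]]]] := hG i.
  have aV0 : 0 < (u i `^ alpha)^-1 by rewrite invr_gt0.
  rewrite -(ltr_pM2r aV0); apply: lt_le_trans Yj.
  rewrite -scale// ltNge; apply/negP => jr.
  by move: large; rewrite ltNge => /negP; apply; exact: (Ew i).
have := subU _ _ mA (mE _ cp0') AE; have := subU _ _ (mE _ cm0') mA EA.
move: hlp hlm hp hm; rewrite !ler_norml.
move=> /andP[? ?] /andP[? ?] /andP[? ?] /andP[? ?] ? ?.
by apply/andP; split; lra.
Unshelve. all: by end_near.
Qed.

End all_levels.

Theorem theorem1p1 (R : realType)
  (d : measure_display) (Omega : measurableType d) (P : probability Omega R)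
  (xi : {RV P >-> R}) (xis : nat -> {RV P >-> R})
  (xi_pos : P [set w | 0 < xi w] = 1%E)
  (xis_copies : forall i (B : set R), measurable B ->
     distribution P (xis i) B = distribution P xi B)
  (xis_indep : independent_family P (fun i => xis i : Omega -> R))
  (L Linv : R -> R)
  (L_ge0 : forall x, 0 <= x -> 0 <= L x)
  (L_slow : slowly_varying L)
  (L_incr : {in `[0, +oo[ &, {homo L : x y / x < y}})
  (L_cont : {within `[0, +oo[, continuous L})
  (L_0 : L 0 = 0)
  (L_infty : L x @[x --> +oo] --> +oo)
  (Linv_ge0 : forall t, 0 <= t -> 0 <= Linv t)
  (LinvK : forall t, 0 <= t -> L (Linv t) = t)
  (LK : forall t, 0 <= t -> Linv (L t) = t)
  (h : R -> R) (alpha : R)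
  (h_ge0 : forall x, 0 <= x -> 0 <= h x)
  (h_meas : measurable_fun `[(0 : R), +oo[ h)
  (h_bounded : locally_bounded h)
  (h_regular : regularly_varying (h \o Linv) alpha)
  (xi_tail : asymp_equiv (fun x => fine (P [set w | x < xi w]))
                         (fun x => 1 / L x))
  (d' : measure_display) (Omega' : measurableType d')
  (P' : probability Omega' R) (X : nat -> Omega' -> R * \bar R)
  (X_poisson : poisson_point_process P' (@extremal_space R)
                 (@extremal_intensity R) X)
  (n : nat) (n_gt0 : (0 < n)%N) (u : 'I_n -> R)
  (u_gt0 : forall i, 0 < u i)
  (u_incr : forall i j : 'I_n, (i < j)%N -> u i < u j) :
  cvg_in_distribution P P'
    (fun t w => \row_i (fine (shot_noise (fun k => xis k : Omega -> R) h
                                (Linv (t * u i)) w) / (t * h (Linv t))))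
    (fun w => \row_i (u i `^ alpha * fine (extremal_inverse X (u i) w))).
Proof.
have L_nd x y : 0 <= x -> x <= y -> L x <= L y.
  move=> x0; rewrite le_eqVlt => /orP[/eqP ->//|xy].
  by apply/ltW/L_incr; rewrite ?in_itv/= ?andbT// (le_trans x0)// ltW.
have L_tail : asymp_equiv (tail xi) (fun x => 1 / L x) by exact: xi_tail.
have a0 i : 0 < u i `^ alpha by rewrite powR_gt0.
pose Z w := \row_i (u i `^ alpha * fine (extremal_inverse X (u i) w)).
have Z_survival (s : 'I_n -> R) : (forall i, 0 <= s i) ->
    P' (survival_event Z s) =
    (expR (- staircase_mass u (fun i => s i / u i `^ alpha)))%:E.
  move=> s0; rewrite -(extremal_inverse_survival X_poisson)//; last first.
    by move=> i; rewrite divr_ge0// ltW.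
  congr (P' _); apply/seteqP; split => w hw i; have := hw i;
    by rewrite mxE ltr_pdivrMr// mulrC.
apply: cvg_in_distribution_survival.
- move=> t i; under eq_fun do rewrite mxE.
  apply: measurable_funM => //; apply: measurableT_comp => //.
  exact: measurable_shot_noise.
- move=> i; under eq_fun do rewrite mxE.
  apply: measurable_funM => //; apply: measurableT_comp => //.
  by apply: (measurable_extremal_inverse X_poisson); exact: ltW.
- move=> s s0; rewrite Z_survival//=.
  have := shot_noise_survival_cvg xi_pos xis_copies xis_indep L_ge0 L_nd L_slow
    L_infty Linv_ge0 LinvK LK h_ge0 h_meas h_regular L_tail u_gt0 u_incr s0.
  apply: cvg_trans; apply: near_eq_cvg; apply: nearW => t.
  congr (fine (P _)); apply/seteqP; split => w hw i; have := hw i; by rewrite mxE.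
(* At threshold 0 the staircase has mass 0, so the coordinates of the limit are almost surely
   positive. *)
- rewrite Z_survival// (_ : (fun i => _) = fun=> 0); last first.
    by apply/funext => i; rewrite mul0r.
  by rewrite staircase_mass0 oppr0 expR0.
Qed.
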